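(* Let $P$ be an APP with stochastic game structure $\mathcal{G}_P$ and let $I$ be a linear invariant for $\mathcal{G}_P$. If there exists an LRSM $\eta$ with respect to $I$ (with constants $\epsilon\ge1$, $K,K'\le-1$), then (1) $P$ is almost-surely terminating, i.e. there is an angelic scheduler $\sigma$ (namely any $\eta$-greedy one) such that $\mathbb{P}^{\sigma,\pi}(T<\infty)=1$ for every demonic scheduler $\pi$; and (2) $\mathsf{ET}(P)\le\frac{\eta(\ell_0,\mathbf{x}_0)-K'}{\epsilon}$, in particular $\mathsf{ET}(P)<\infty$ (indeed $\sup_\pi\mathbb{E}^{\sigma,\pi}[T]\le\frac{\eta(\ell_0,\mathbf{x}_0)-K'}{\epsilon}$ for every $\eta$-greedy $\sigma$).
   Context: Affine probabilistic programs (APPs) and their semantics. An APP $P$ has finitely many real-valued program variables $X=\{x_1,\dots,x_{|X|}\}$ with a given initial valuation $\mathbf{x}_0\in\mathbb{R}^{|X|}$, and finitely many real-valued random variables $R$ with a fixed joint distribution $\mathcal{D}$ whose every component is integrable; a fresh sample $\mathbf{r}\sim\mathcal{D}$ is drawn at each step, independently of the past. $P$ is built from assignments $x:=e$ ($e$ an affine expression over program and random variables), skip, sequencing, while loops guarded by propositionally linear predicates (finite disjunctions of linear assertions; a linear assertion is a finite conjunction of linear constraints, each a non-strict inequality between affine expressions or its negation), and if-then-else statements whose guard is either a propositionally linear predicate or one of the keywords angel (angelic nondeterministic choice), demon (demonic nondeterministic choice), prob($p$) (then-branch taken with probability $p\in[0,1]$). $P$ is interpreted as a stochastic game structure $\mathcal{G}_P$: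 a finite set $L$ of locations partitioned into angelic, demonic, probabilistic and deterministic locations; an initial location $\ell_0$; a deterministic terminal location $\ell_{out}$ with an identity self-loop; and transitions $(\ell,f,\ell')$ with affine update functions $f:\mathbb{R}^{|X|}\times\mathbb{R}^{|R|}\to\mathbb{R}^{|X|}$. An assignment yields a deterministic location with one transition performing the update; all other transitions (control flow, and all transitions out of angelic, demonic and probabilistic locations) have the identity update $id$. Each location has at most two outgoing transitions; a probabilistic location $\ell$ carries a probability distribution $Pr_\ell$ over its outgoing transitions; each transition $\tau$ out of a deterministic location has a guard $G(\tau)$ (a propositionally linear predicate), and the guards of the transitions out of one location are mutually exclusive and jointly exhaustive. A configuration is a pair $(\ell,\mathbf{x})$. An angelic (resp. demonic) scheduler maps every finite sequence of configurations ending in an angelic (resp. demonic) location $\ell$ to a transition out of $\ell$. For an angelic scheduler $\sigma$ and demonic scheduler $\pi$, a run $c_1c_2\cdots$ is generated from $c_1=(\ell_0,\mathbf{x}_0)$: if $c_n=(\ell,\mathbf{x})$, sample $\mathbf{r}\sim\mathcal{D}$, pick a transition $(\ell,f,\ell')$ out of $\ell$ (by $\sigma$ resp. $\pi$ applied to $c_1\cdots c_n$ if $\ell$ is angelic resp. demonic; randomly according to $Pr_\ell$ if probabilistic; the unique one whose guard $\mathbf{x}$ satisfies if deterministic) and set $c_{n+1}=(\ell',f(\mathbf{x},\mathbf{r}))$. This yields a probability measure $\mathbb{P}^{\sigma,\pi}$ on runs with expectation $\mathbb{E}^{\sigma,\pi}$. Let $\theta_n$ and $\overline{\mathbf{x}}_n$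 be the location and valuation of $c_n$, let $\mathcal{F}_n$ be the $\sigma$-algebra generated by $\theta_j,\overline{\mathbf{x}}_j$ for $j\le n$, and let $T=\min\{n:\theta_n=\ell_{out}\}$ ($\min\emptyset=\infty$) be the termination time. $\mathsf{ET}(P)=\inf_\sigma\sup_\pi\mathbb{E}^{\sigma,\pi}[T]$. A configuration is reachable if it occurs on some finite path from $(\ell_0,\mathbf{x}_0)$ (consecutive configurations related by a transition enabled in the first one and some value $\mathbf{r}$ in the range of the random variables). Linear invariants and LRSMs. A linear invariant $I$ assigns to each location $\ell$ a finite set $I(\ell)$ of linear assertions over $X$ such that every reachable configuration $(\ell,\mathbf{x})$ satisfies $\mathbf{x}\in\bigcup I(\ell)$. For $\eta:L\times\mathbb{R}^{|X|}\to\mathbb{R}$, the pre-expectation $\mathrm{pre}_\eta(\ell,\mathbf{x})$ equals $\sum_{(\ell,id,\ell')}Pr_\ell(\ell,id,\ell')\,\eta(\ell',\mathbf{x})$ if $\ell$ is probabilistic; $\max_{(\ell,id,\ell')}\eta(\ell',\mathbf{x})$ if $\ell$ is demonic; $\min_{(\ell,id,\ell')}\eta(\ell',\mathbf{x})$ if $\ell$ is angelic; and $\eta(\ell',\mathbb{E}_{\mathbf{r}\sim\mathcal{D}}f(\mathbf{x},\mathbf{r}))$ if $\ell$ is deterministic and $(\ell,f,\ell')$ is the transition whose guard $\mathbf{x}$ satisfies. A linear ranking-supermartingale map (LRSM) with respect to $I$ is a function $\eta:L\times\mathbb{R}^{|X|}\to\mathbb{R}$ for which there exist $\epsilon\ge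 1$ and $K,K'\le -1$ such that for all $\ell\in L$, $\mathbf{x}\in\mathbb{R}^{|X|}$: (C1) $\eta(\ell,\cdot)$ is affine; (C2) if $\ell\ne\ell_{out}$ and $\mathbf{x}\in\bigcup I(\ell)$ then $\eta(\ell,\mathbf{x})\ge0$; (C3) if $\ell=\ell_{out}$ and $\mathbf{x}\in\bigcup I(\ell)$ then $K'\le\eta(\ell,\mathbf{x})\le K$; (C4) if $\ell\ne\ell_{out}$ and $\mathbf{x}\in\bigcup I(\ell)$ then $\mathrm{pre}_\eta(\ell,\mathbf{x})\le\eta(\ell,\mathbf{x})-\epsilon$. An angelic scheduler is $\eta$-greedy if, on every finite path ending in a configuration $(\ell,\mathbf{x})$ with $\ell$ angelic, it chooses a transition $(\ell,id,\ell')$ with $\eta(\ell',\mathbf{x})=\min_{(\ell,id,\ell'')}\eta(\ell'',\mathbf{x})$.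
   Formalization: T is taken as the number of steps (initial configuration has index 0, not 1), since with c_1 initial the bound fails by one (P = skip, η(ℓ0)=0, η(ℓ_out)=K=K'=-1, ε=1: bound 1, T=2); schedulers are required to be measurable so that the run measure is defined. *)

(* Defs.v *)
From Stdlib Require List.
From HB Require Import structures.
From mathcomp Require Import all_boot all_order all_algebra.
From mathcomp Require Import all_classical all_reals all_analysis.
Set Implicit Arguments.
Unset Strict Implicit.
Unset Printing Implicit Defensive.
Import Order.TTheory GRing.Theory Num.Theory.
Local Open Scope classical_set_scope.
Local Open Scope ring_scope.

Section Linear.
Variables (R : realType) (n : nat).

(* a constraint  0 <= coef . x + const  (an affine non-strict inequality,
   every non-strict inequality e1 <= e2 between affine expressions is of this
   form with coef/const those of e2 - e1), or its negation if lc_neg = true. *)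
Record lin_constraint := LinC {
  lc_coef : 'rV[R]_n; lc_const : R; lc_neg : bool }.

Definition lc_val (c : lin_constraint) (x : 'rV[R]_n) : R :=
  \sum_(i < n) lc_coef c 0 i * x 0 i + lc_const c.

Definition sat_constraint (c : lin_constraint) (x : 'rV[R]_n) : bool :=
  if lc_neg c then ~~ (0 <= lc_val c x) else 0 <= lc_val c x.

Definition lin_assertion := seq lin_constraint.
Definition sat_assertion (a : lin_assertion) (x : 'rV[R]_n) : bool :=
  all (fun c => sat_constraint c x) a.

(* propositionally linear predicate = finite disjunction of linear assertions;
   also used for a finite set of linear assertions (read as their union) *)
Definition lin_pred := seq lin_assertion.
Definition sat_pred (p : lin_pred) (x : 'rV[R]_n) : bool :=
  has (fun a => sat_assertion a x) p.

Definition affine_fun (g : 'rV[R]_n -> R) : Prop :=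
  exists (a : 'rV[R]_n) (b : R), forall x, g x = \sum_(i < n) a 0 i * x 0 i + b.

End Linear.

Definition affine_upd (R : realType) (nX nR : nat)
  (f : 'rV[R]_nX -> 'rV[R]_nR -> 'rV[R]_nX) : Prop :=
  exists (A : 'M[R]_(nX, nX)) (B : 'M[R]_(nR, nX)) (c : 'rV[R]_nX),
    forall x r, f x r = x *m A + r *m B + c.

Inductive loc_kind := KAngel | KDemon | KProb | KDet.

Section Game.
Variables (R : realType) (nX nR : nat).

Definition vecX := 'rV[R]_nX.
Definition vecR := 'rV[R]_nR.

(* an outgoing transition (l, e_upd, e_dst) of a location l; e_guard is its
   guard G(tau) (only meaningful for deterministic locations) and e_prob its
   probability Pr_l(tau) (only meaningful for probabilistic locations). *)
Record edge (L : Type) := Edge {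
  e_upd : vecX -> vecR -> vecX;
  e_dst : L;
  e_guard : lin_pred R nX;
  e_prob : R }.

Record sgs (L : finType) := SGS {
  kind : L -> loc_kind;
  l_init : L;
  l_out : L;
  out : L -> seq (edge L)
}.

Variable (L : finType).
Implicit Type G : sgs L.

Definition wf_sgs G : Prop :=
  kind G (l_out G) = KDet /\
  (exists e, out G (l_out G) = [:: e] /\ e_dst e = l_out G /\
             forall x r, e_upd e x r = x) /\
  (forall l, (0 < size (out G l) <= 2)%N) /\
  (forall l e, List.In e (out G l) -> affine_upd (e_upd e)) /\
  (forall l, kind G l <> KDet ->
     forall e, List.In e (out G l) -> forall x r, e_upd e x r = x) /\
  (forall l, kind G l = KProb ->
     (forall e, List.In e (out G l) -> 0 <= e_prob e) /\
     \sum_(e <- out G l) e_prob e = 1) /\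
  (forall l, kind G l = KDet ->
     forall x, count (fun e => sat_pred (e_guard e) x) (out G l) = 1%N).

Definition config := (L * vecX)%type.

(* the i-th outgoing transition of l (the first one if i is out of range) *)
Definition edge_at G (l : L) (i : nat) : edge L :=
  nth (nth (Edge (fun x _ => x) l [::] 0) (out G l) 0) (out G l) i.

Definition det_edge G (l : L) (x : vecX) : edge L :=
  edge_at G l (find (fun e => sat_pred (e_guard e) x) (out G l)).

(* schedulers: a choice among the (at most two) transitions out of the last
   location of a finite sequence of configurations (false = first, true =
   second transition); only used when the last location is angelic (resp.
   demonic). *)
Definition scheduler := seq config -> bool.

(* one step of the run: given the history h, the sampled value r of the
   random variables, and a uniform [0,1] sample v used to resolve
   probabilistic choice (the first transition is taken iff v < its
   probability). *)
Definition step G (sig pi : scheduler) (h : seq config) (r : vecR) (v : R)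
  : config :=
  let: (l, x) := last (l_init G, (0 : vecX)) h in
  let e := match kind G l with
           | KAngel => edge_at G l (sig h)
           | KDemon => edge_at G l (pi h)
           | KProb => edge_at G l (if v < e_prob (edge_at G l 0) then 0 else 1)
           | KDet => det_edge G l x
           end in
  (e_dst e, e_upd e x r).

Definition hist_gens G : set (set (seq config)) :=
  [set A | (exists k, A = [set h | size h = k]) \/
           (exists i l, A = [set h | (nth (l_init G, (0 : vecX)) h i).1 = l]) \/
           (exists i j (B : set R), measurable B /\
              A = [set h | B ((nth (l_init G, (0 : vecX)) h i).2 0 j)])].

Definition sched_measurable G (s : scheduler) : Prop :=
  <<s hist_gens G >> [set h | s h].

End Game.

(* Probabilistic setting: a probability space carrying the i.i.d. samples   *)
(* r_0, r_1, ... ~ D of the random variables and independent uniform [0,1]   *)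
(* samples v_0, v_1, ... used for probabilistic branching.                  *)

Section Prob.
Variables (R : realType) (nX nR : nat) (d : measure_display)
  (Omega : measurableType d) (P : probability Omega R)
  (samp : nat -> Omega -> 'rV[R]_nR) (unif : nat -> Omega -> R).

Local Open Scope ereal_scope.

Definition sampling_ok : Prop :=
  [/\ (forall k j, measurable_fun setT (fun w => samp k w ord0 j)),
      (forall k, measurable_fun setT (unif k)),
      (* independence, identical distribution D (= law of samp 0), uniform v *)
      (forall (N : nat) (B : nat -> 'I_nR -> set R) (C : nat -> set R),
         (forall i j, measurable (B i j)) -> (forall i, measurable (C i)) ->
         P (\bigcap_(i in `I_N)
              ([set w | forall j, B i j (samp i w ord0 j)] `&` (unif i @^-1` C i)))
         = \prod_(i < N)
              (P [set w | forall j, B i j (samp 0 w ord0 j)] *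
               lebesgue_measure (C i `&` `[0%R, 1%R]))) &
      (forall j, P.-integrable setT (fun w => (samp 0 w ord0 j)%:E))].

(* the range of the random variables: the support of D *)
Definition in_range (r : 'rV[R]_nR) : Prop :=
  forall e : R, (0 < e)%R ->
    0 < P [set w | forall j, (`|samp 0 w ord0 j - r ord0 j| < e)%R].

Definition exp_upd (f : 'rV[R]_nX -> 'rV[R]_nR -> 'rV[R]_nX) (x : 'rV[R]_nX)
  : 'rV[R]_nX :=
  \row_j fine (\int[P]_w (f x (samp 0 w) ord0 j)%:E).

Variables (L : finType) (G : sgs R nX nR L) (x0 : 'rV[R]_nX).

Definition trans_rel (c c' : config R nX L) : Prop :=
  exists e r, List.In e (out G c.1) /\
    (kind G c.1 = KDet -> sat_pred (e_guard e) c.2) /\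
    in_range r /\ c' = (e_dst e, e_upd e c.2 r).

Definition fin_path (h : seq (config R nX L)) : Prop :=
  exists h', h = (l_init G, x0) :: h' /\
    forall i, (i < size h')%N ->
      trans_rel (nth (l_init G, x0) h i) (nth (l_init G, x0) h i.+1).

Definition reachable (c : config R nX L) : Prop :=
  exists h, fin_path h /\ last (l_init G, x0) h = c.

Definition lin_invariant (I : L -> lin_pred R nX) : Prop :=
  forall c, reachable c -> sat_pred (I c.1) c.2.

Definition pre_exp (eta : L -> 'rV[R]_nX -> R) (l : L) (x : 'rV[R]_nX) : R :=
  match kind G l with
  | KProb => (\sum_(e <- out G l) e_prob e * eta (e_dst e) x)%R
  | KDemon => \big[Num.max/eta (e_dst (edge_at G l 0)) x]_(e <- out G l)
                 eta (e_dst e) x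
  | KAngel => \big[Num.min/eta (e_dst (edge_at G l 0)) x]_(e <- out G l)
                 eta (e_dst e) x
  | KDet => let e := det_edge G l x in eta (e_dst e) (exp_upd (e_upd e) x)
  end.

Definition LRSM (I : L -> lin_pred R nX) (eta : L -> 'rV[R]_nX -> R)
  (eps K K' : R) : Prop :=
  [/\ (1 <= eps)%R, (K <= -1)%R, (K' <= -1)%R,
      (forall l, affine_fun (eta l)) &
      (forall l x, sat_pred (I l) x ->
        [/\ l <> l_out G -> (0 <= eta l x)%R,
            l = l_out G -> (K' <= eta l x <= K)%R &
            l <> l_out G -> (pre_exp eta l x <= eta l x - eps)%R])].

Definition greedy (eta : L -> 'rV[R]_nX -> R) (sig : scheduler R nX L) : Prop :=
  forall h, fin_path h -> let: (l, x) := last (l_init G, x0) h in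
    kind G l = KAngel ->
    forall e, List.In e (out G l) ->
      (eta (e_dst (edge_at G l (sig h))) x <= eta (e_dst e) x)%R.

Fixpoint hist (sig pi : scheduler R nX L) (k : nat) (w : Omega)
  : seq (config R nX L) :=
  match k with
  | 0%N => [:: (l_init G, x0)]
  | k'.+1 => let h := hist sig pi k' w in
             rcons h (step G sig pi h (samp k' w) (unif k' w))
  end.

Definition theta (sig pi : scheduler R nX L) (k : nat) (w : Omega) : L :=
  (last (l_init G, x0) (hist sig pi k w)).1.

(* termination time T = min {k | theta_k = l_out}, min of empty set = +oo *)
Definition term_time (sig pi : scheduler R nX L) (w : Omega) : \bar R :=
  ereal_inf ((fun k : nat => (k%:R)%:E) @` [set k | theta sig pi k w = l_out G]).

Definition exp_term_time (sig pi : scheduler R nX L) : \bar R :=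
  \int[P]_w term_time sig pi w.

Definition ET : \bar R :=
  ereal_inf [set ereal_sup [set exp_term_time sig pi | pi in sched_measurable G]
            | sig in sched_measurable G].

End Prob.

(* Main.v *)
(* By greediness of the angelic scheduler, the expectation of eta at the next
   configuration is at most its present value minus eps, as long as the program
   has not terminated and the current history is a genuine finite path; and
   almost every run is one, because a sample almost surely lies in the support
   of its distribution.  Since eta is bounded below by K' along such paths,
   telescoping the expectations gives
   eps * \sum_(k < n) P(theta_k <> l_out) <= eta(l_0, x_0) - K' for every n, and
   E[T] is the supremum of these sums over n because l_out is absorbing.
   The only probabilistic input is that the n-th draw is independent of the
   history up to time n, which follows from the pi-lambda theorem applied to
   the boxes generating the past. *)

(* No conditional expectation is ever formed. The location and the chosen edge take finitely many
   values, so each integral is a finite sum, over pairs of a location and a bit, of integrals with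
   an indicator in front. For a fixed pair the next value of [eta] is affine in the valuation and
   the sample, with no product of the two; replacing the sample by its mean then only needs each
   coordinate of the sample to be independent of a history event. This is what affineness of [eta]
   and of the updates buys. Probabilistic locations are the one place where the chosen edge depends
   on the current draw; there the update is the identity, so the sample drops out and only the
   independence of the uniform variable from the history remains. Schedulers see the whole history,
   hence the care about measurability of histories, both for the ambient sigma-algebra and for that
   of the past. *)
Require Import Defs.
From HB Require Import structures.
From mathcomp Require Import all_boot all_order all_algebra.
From mathcomp Require Import all_classical all_reals all_analysis measurable_realfun.
From mathcomp Require Import lra.
Import Order.TTheory GRing.Theory Num.Theory.
Local Open Scope classical_set_scope.
Local Open Scope ring_scope.
Set Implicit Arguments.
Unset Strict Implicit.
Unset Printing Implicit Defensive.

(** * Integration against an independent event *)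

Section indep.
Context d (T : measurableType d) (R : realType) (P : probability T R).
Context d' (U : measurableType d').

Local Open Scope ereal_scope.

(** Independence says that the pushforward under [f] of [P] restricted to [E] is [P E] times the
    pushforward of [P]; integrating [X] against both measures gives the claim. *)
Lemma ge0_integral_indep (f : T -> U) (X : U -> \bar R) (E : set T) :
  measurable_fun setT f -> measurable_fun setT X -> measurable E ->
  (forall x, 0 <= X x) ->
  (forall S, measurable S -> P (f @^-1` S `&` E) = P (f @^-1` S) * P E) ->
  \int[P]_(w in E) X (f w) = P E * \int[P]_w X (f w).
Proof.
move=> mf mX mE X0 ind.
have mXf : measurable_fun setT (X \o f) by exact: measurableT_comp.
pose m1 : {measure set T -> \bar R} := mrestr P mE.
have PE : P E = (fine (P E))%:E by rewrite fineK// fin_num_measure.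
have q0 : (0 <= fine (P E))%R by rewrite fine_ge0.
pose m2' : {measure set U -> \bar R} :=
  mscale (NngNum q0) (pushforward P f).
transitivity (\int[m1]_w X (f w)).
  have mEC : measurable (~` E) by exact: measurableC.
  rewrite -(setUv E) ge0_integral_setU//=; last 2 first.
  - exact: measurable_funTS.
  - by rewrite disj_set2E setICr.
  (* [m1] gives no mass to the complement of [E], so integrating [m1] over everything is integrating
     [P] over [E]. *)
  rewrite [X in _ + X](_ : _ = 0); last first.
    apply: null_set_integral => //.
    - exact: measurable_funTS.
    - by rewrite /m1 /= /mrestr setICl measure0.
  rewrite adde0; apply: eq_measure_integral => A mA AE.
  by rewrite /m1 /= /mrestr setIidl.
transitivity (\int[pushforward m1 f]_y X y).
  by rewrite ge0_integral_pushforward.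
pose m2 : {measure set U -> \bar R} := m2' mf.
transitivity (\int[m2]_y X y).
  apply: eq_measure_integral => A mA _.
  by rewrite /m1 /m2 /m2' /= /mrestr /mscale /= /pushforward ind// -PE muleC.
rewrite /m2 /m2' ge0_integral_mscale//= -PE; congr (_ * _).
by rewrite ge0_integral_pushforward.
Qed.

(** The positive and negative parts of [X] are treated separately; integrability keeps their
    difference well defined when the probability of the event is distributed over it. *)
Lemma integral_indep (f : T -> U) (X : U -> R) (b : T -> bool) :
  measurable_fun setT f -> measurable_fun setT X -> measurable_fun setT b ->
  P.-integrable setT (fun w => (X (f w))%:E) ->
  (forall S, measurable S -> P (f @^-1` S `&` [set w | b w]) =
                             P (f @^-1` S) * P [set w | b w]) ->
  (\int[P]_w ((b w)%:R * X (f w)) = fine (P [set w | b w]) * \int[P]_w X (f w))%R.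
Proof.
move=> mf mX mb iX ind.
have mE : measurable [set w | b w].
  have := mb measurableT [set true] I; rewrite setTI.
  by congr measurable; apply/seteqP; split => w /=.
have -> : (\int[P]_w ((b w)%:R * X (f w)))%R
    = fine (\int[P]_(w in [set w | b w]) (X (f w))%:E).
  rewrite integral_mkcond; congr fine; apply: eq_integral => w _ /=.
  rewrite /patch mem_setE -[w \in b]/(b w).
  by case: (b w); rewrite ?mul1r ?mul0r.
pose Y : U -> \bar R := EFin \o X.
have mY : measurable_fun setT Y by exact/measurable_EFinP.
have PE : P [set w | b w] \is a fin_num by rewrite fin_num_measure.
have iXf : \int[P]_w (X (f w))%:E \is a fin_num by exact: integrable_fin_num.
transitivity (fine (P [set w | b w] * \int[P]_w (X (f w))%:E)); last first.
  by rewrite fineM.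
congr fine.
rewrite [in LHS]integralE [in X in _ * X]integralE.
have -> : (fun w => (X (f w))%:E)^\+ = Y^\+ \o f by rewrite /Y -funepos_comp.
have -> : (fun w => (X (f w))%:E)^\- = Y^\- \o f by rewrite /Y -funeneg_comp.
rewrite muleBr//; last first.
  rewrite fin_num_adde_defr//.
  have := integrable_pos_fin_num measurableT iX.
  by have -> : (fun w => (X (f w))%:E)^\+ = Y^\+ \o f by rewrite /Y -funepos_comp.
have mYp : measurable_fun setT Y^\+ by exact: measurable_funepos.
have mYn : measurable_fun setT Y^\- by exact: measurable_funeneg.
have Yp0 x : 0 <= Y^\+ x by exact: funepos_ge0.
have Yn0 x : 0 <= Y^\- x by exact: funeneg_ge0.
have := ge0_integral_indep mf mYn mE Yn0 ind.
have := ge0_integral_indep mf mYp mE Yp0 ind.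
by move=> <- <-.
Qed.

End indep.

(** * Measurability of histories *)

HB.instance Definition _ (T : choiceType) := isPointed.Build (seq T) [::].

Lemma measurable_bool_set d (T : measurableType d) (b : T -> bool) :
  measurable [set w | b w] <-> measurable_fun setT b.
Proof.
split=> [mb|mb]; first by apply: (measurable_fun_bool true); rewrite setTI.
by have := mb measurableT [set true] I; rewrite setTI.
Qed.

Lemma measurable_natr_bool d (T : measurableType d) (R : realType) (b : T -> bool) :
  measurable_fun setT b -> measurable_fun setT (fun w => (b w)%:R : R).
Proof.
move=> mb; have -> : (fun w => (b w)%:R) = (fun w => if b w then 1 else 0 : R).
  by apply/funext => w; case: (b w).
exact: measurable_fun_ifT.
Qed.

Section affine.
Context (R : realType) (n : nat).

Lemma measurable_affine d (T : measurableType d) (X : T -> 'rV[R]_n)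
    (g : 'rV[R]_n -> R) :
  affine_fun g -> (forall j, measurable_fun setT (fun w => X w 0 j)) ->
  measurable_fun setT (fun w => g (X w)).
Proof.
move=> [a [b gE]] mX.
under eq_fun do rewrite gE.
apply: measurable_funD => //; apply: measurable_sum => i.
exact: measurable_funM.
Qed.

Lemma measurable_sat_pred d (T : measurableType d) (X : T -> 'rV[R]_n)
    (p : lin_pred R n) :
  (forall j, measurable_fun setT (fun w => X w 0 j)) ->
  measurable_fun setT (fun w => sat_pred p (X w)).
Proof.
move=> mX; rewrite /sat_pred; elim: p => [|a p IHp] //=.
apply: measurable_or => //; rewrite /sat_assertion.
elim: a => [|c a IHa] //=.
apply: measurable_and => //; rewrite /sat_constraint.
have mc : measurable_fun setT (fun w => 0 <= lc_val c (X w)).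
  apply: measurable_fun_ler => //.
  by apply: measurable_affine => //; exists (lc_coef c), (lc_const c).
by case: (lc_neg c) => //; apply: measurable_neg.
Qed.

End affine.

(** * One step of the game, driven by a single bit *)

Section game.
Context (R : realType) (nX nR : nat) (L : finType) (G : sgs R nX nR L).
Implicit Types (sig pi : scheduler R nX L) (h : seq (config R nX L)).

Definition loc h : L := (last (l_init G, (0 : 'rV[R]_nX)) h).1.
Definition val h : 'rV[R]_nX := (last (l_init G, (0 : 'rV[R]_nX)) h).2.

Definition dst (l : L) (b : bool) : L := e_dst (edge_at G l b).
Definition upd (l : L) (b : bool) : 'rV[R]_nX -> 'rV[R]_nR -> 'rV[R]_nX :=
  e_upd (edge_at G l b).

(* false = first, true = second outgoing transition, as in schedulers *)
Definition sel sig pi h (v : R) : bool :=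
  match kind G (loc h) with
  | KAngel => sig h
  | KDemon => pi h
  | KProb => ~~ (v < e_prob (edge_at G (loc h) 0))
  | KDet => ~~ sat_pred (e_guard (edge_at G (loc h) 0)) (val h)
  end.

Context (wfG : wf_sgs G).

Lemma out_cases (l : L) :
  (exists e, out G l = [:: e]) \/ (exists e1 e2, out G l = [:: e1; e2]).
Proof.
have [_ [_ [/(_ l) + _]]] := wfG.
case: (out G l) => [//|e1 [|e2 [|//]]] _; first by left; exists e1.
by right; exists e1, e2.
Qed.

Lemma edge_at_in (l : L) (b : bool) : List.In (edge_at G l b) (out G l).
Proof.
(* With a single outgoing edge, index 1 falls back to that edge, the default value in [edge_at], so
   either bit is legal. *)
rewrite /edge_at; have [[e ->]|[e1 [e2 ->]]] := out_cases l.
  by case: b; left.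
by case: b => /=; [right; left|left].
Qed.

Lemma edge_atP (l : L) e : List.In e (out G l) -> exists b : bool, e = edge_at G l b.
Proof.
rewrite /edge_at; have [[e' ->]|[e1 [e2 ->]]] := out_cases l => /=.
  by move=> [<-|//]; exists false.
by move=> [<-|[<-|//]]; [exists false|exists true].
Qed.

(** Exactly one of at most two guards holds, so the first guard decides: if it fails, there is a
    second edge and its guard holds. *)
Lemma det_edgeE (l : L) x : kind G l = KDet ->
  det_edge G l x = edge_at G l (~~ sat_pred (e_guard (edge_at G l 0)) x).
Proof.
have [_ [_ [_ [_ [_ [_ detG]]]]]] := wfG.
move=> /detG /(_ x); rewrite /det_edge /edge_at.
have [[e ->]|[e1 [e2 ->]]] := out_cases l => /=.
  by case: (sat_pred (e_guard e) x).
by case: (sat_pred (e_guard e1) x) => //=; case: (sat_pred (e_guard e2) x).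
Qed.

Lemma det_edge_sat (l : L) x : kind G l = KDet ->
  sat_pred (e_guard (det_edge G l x)) x.
Proof.
have [_ [_ [_ [_ [_ [_ detG]]]]]] := wfG.
move=> /detG /(_ x); rewrite /det_edge /edge_at.
have [[e ->]|[e1 [e2 ->]]] := out_cases l => /=.
  by case s : (sat_pred (e_guard e) x) => //= _; rewrite s.
case s1 : (sat_pred (e_guard e1) x) => //=.
by case s2 : (sat_pred (e_guard e2) x) => //= _; rewrite s2.
Qed.

(** All four kinds of locations reduce to one bit, so that later arguments can split over [L * bool]
    instead of over kinds. *)
Lemma stepE sig pi h r v : step G sig pi h r v =
  (dst (loc h) (sel sig pi h v), upd (loc h) (sel sig pi h v) (val h) r).
Proof.
rewrite /step /dst /upd /sel /loc /val; case: (last _ h) => l x /=.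
case k : (kind G l) => //; first by case: (v < _).
by rewrite det_edgeE.
Qed.

Lemma upd_id (l : L) b x r : kind G l <> KDet -> upd l b x r = x.
Proof.
have [_ [_ [_ [_ [idG _]]]]] := wfG.
by move=> /idG; apply; exact: edge_at_in.
Qed.

Lemma upd_out b x r : upd (l_out G) b x r = x.
Proof.
have [_ [[e [oE [_ eid]]] _]] := wfG.
by rewrite /upd /edge_at oE; case: b => /=; rewrite eid.
Qed.

Lemma dst_out b : dst (l_out G) b = l_out G.
Proof.
have [_ [[e [oE [eout _]]] _]] := wfG.
by rewrite /dst /edge_at oE; case: b => /=; rewrite eout.
Qed.

Lemma affine_upd_edge (l : L) b : affine_upd (upd l b).
Proof.
have [_ [_ [_ [aff _]]]] := wfG; exact/aff/edge_at_in.
Qed.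

Let H := g_sigma_algebraType (hist_gens G).

Lemma measurable_size k : measurable [set h : H | size h = k].
Proof. by apply: sub_sigma_algebra; left; exists k. Qed.

(** The generators speak of the length and of entries at a fixed index, never of the last entry;
    slicing by length turns the last entry into one at a fixed index. For the empty history [nth]
    and [last] both return the default. *)
Lemma last_nth_bigcup (A : set (config R nX L)) :
  [set h : H | A (last (l_init G, (0 : 'rV[R]_nX)) h)] =
  \bigcup_k ([set h : H | size h = k] `&`
     [set h : H | A (nth (l_init G, (0 : 'rV[R]_nX)) h k.-1)]).
Proof.
apply/seteqP; split=> h /=; first by move=> Ah; exists (size h) => //=; rewrite nth_last.
by move=> [k _ [/= <-]]; rewrite nth_last.
Qed.

Lemma measurable_loc (l : L) : measurable_fun setT (fun h : H => loc h == l).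
Proof.
apply/measurable_bool_set.
rewrite [X in measurable X](_ : _ = [set h : H | (last (l_init G, (0 : 'rV[R]_nX)) h).1 = l]); last first.
  by apply/seteqP; split => h /= /eqP.
rewrite (last_nth_bigcup [set c : config R nX L | c.1 = l]).
apply: bigcup_measurable => k _; apply: measurableI; first exact: measurable_size.
by apply: sub_sigma_algebra; right; left; exists k.-1, l.
Qed.

Lemma measurable_val j : measurable_fun setT (fun h : H => val h 0 j).
Proof.
move=> _ B mB; rewrite setTI.
rewrite [X in measurable X](_ : _ = [set h : H | B ((last (l_init G, (0 : 'rV[R]_nX)) h).2 0 j)])//.
rewrite (last_nth_bigcup [set c : config R nX L | B (c.2 0 j)]).
apply: bigcup_measurable => k _; apply: measurableI; first exact: measurable_size.
by apply: sub_sigma_algebra; right; right; exists k.-1, j, B.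
Qed.

(** [L] is finite, so the preimage splits along the level sets of [l], and on each of them the
    location is a constant. *)
Lemma measurable_by_loc d (T : measurableType d) d' (U : measurableType d')
    (l : T -> L) (F : L -> T -> U) :
  (forall l0, measurable_fun setT (fun w => l w == l0)) ->
  (forall l0, measurable_fun setT (F l0)) ->
  measurable_fun setT (fun w => F (l w) w).
Proof.
move=> ml mF _ B mB; rewrite setTI.
rewrite [X in measurable X](_ : _ =
    \bigcup_(l0 in [set: L]) ([set w | l w == l0] `&` (F l0 @^-1` B))).
  apply: fin_bigcup_measurable => [|l0 _]; first exact: finite_finset.
  apply: measurableI; first exact/measurable_bool_set.
  by rewrite -[X in measurable X]setTI; apply: mF.
apply/seteqP; split=> w /=.
  by move=> Bw; exists (l w) => //=; split.
by move=> [l0 _ [/= /eqP <-]].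
Qed.

End game.

Lemma measurable_affine_upd (R : realType) (nX nR : nat) d (T : measurableType d)
    (f : 'rV[R]_nX -> 'rV[R]_nR -> 'rV[R]_nX) (X : T -> 'rV[R]_nX)
    (Y : T -> 'rV[R]_nR) j :
  affine_upd f ->
  (forall i, measurable_fun setT (fun w => X w 0 i)) ->
  (forall i, measurable_fun setT (fun w => Y w 0 i)) ->
  measurable_fun setT (fun w => f (X w) (Y w) 0 j).
Proof.
move=> [A [B [c fE]]] mX mY.
under eq_fun do rewrite fE !mxE.
apply: measurable_funD => //; apply: measurable_funD.
  by apply: measurable_sum => i; exact: measurable_funM.
by apply: measurable_sum => i; exact: measurable_funM.
Qed.

Section hist_measurable.
Context (R : realType) (nX nR : nat) (L : finType) (G : sgs R nX nR L)
  (x0 : 'rV[R]_nX) (wfG : wf_sgs G) (sig pi : scheduler R nX L).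
Let H := g_sigma_algebraType (hist_gens G).
Context (msig : sched_measurable G sig) (mpi : sched_measurable G pi).

Lemma size_hist d (T : measurableType d) (samp : nat -> T -> 'rV[R]_nR)
    (unif : nat -> T -> R) k w :
  size (hist samp unif G x0 sig pi k w) = k.+1.
Proof. by elim: k => [//|k IH] /=; rewrite size_rcons IH. Qed.

Lemma loc_rcons h c : loc G (rcons h c) = c.1.
Proof. by rewrite /loc last_rcons. Qed.

Lemma val_rcons h c : val G (rcons h c) = c.2.
Proof. by rewrite /val last_rcons. Qed.

Lemma measurable_sched (s : scheduler R nX L) : sched_measurable G s ->
  measurable_fun setT (s : H -> bool).
Proof. by move=> ms; apply/measurable_bool_set. Qed.

Lemma measurable_sel d (T : measurableType d) (f : T -> H) (v : T -> R) :
  measurable_fun setT f -> measurable_fun setT v ->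
  measurable_fun setT (fun w => sel G sig pi (f w) (v w)).
Proof.
move=> mf mv.
pose F l w := match kind G l with
  | KAngel => sig (f w)
  | KDemon => pi (f w)
  | KProb => ~~ (v w < e_prob (edge_at G l 0))
  | KDet => ~~ sat_pred (e_guard (edge_at G l 0)) (val G (f w))
  end.
apply: (@measurable_by_loc L _ _ _ _ (fun w => loc G (f w)) F) => l.
  by apply: (measurableT_comp (measurable_loc l)).
rewrite /F; case: (kind G l).
- exact: measurableT_comp (measurable_sched msig) mf.
- exact: measurableT_comp (measurable_sched mpi) mf.
- by apply: measurable_neg; exact: measurable_fun_ltr.
- apply: measurable_neg; apply: measurable_sat_pred => j.
  exact: (measurableT_comp (measurable_val j)).
Qed.

Context d (T : measurableType d) (samp : nat -> T -> 'rV[R]_nR)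
  (unif : nat -> T -> R) (n : nat).
Context (msamp : forall i, (i < n)%N ->
                   forall j, measurable_fun setT (fun w => samp i w 0 j))
        (munif : forall i, (i < n)%N -> measurable_fun setT (unif i)).

Let hst k : T -> H := hist samp unif G x0 sig pi k.

(** The measurable structure on [T] is arbitrary and only the draws before [n] are assumed
    measurable. This allows two uses: with the sigma-algebra of [Omega], and with the one generated
    by the past, where it says that a history depends on earlier draws only. *)
Lemma measurable_hist k : (k <= n)%N -> measurable_fun setT (hst k).
Proof.
(* Length conditions, and entries beyond the end of the history, do not depend on [w]. *)
have mcst (Q : Prop) : measurable [set _ : T | Q].
  have [q|q] := pselect Q.
    by rewrite (_ : [set _ | Q] = setT)//; apply/seteqP; split.
  by rewrite (_ : [set _ | Q] = set0)//; apply/seteqP; split.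
elim: k => [_|k IH kn].
  by rewrite /hst /=; exact: measurable_cst.
have {IH}mh := IH (ltnW kn).
have msel : measurable_fun setT (fun w => sel G sig pi (hst k w) (unif k w)).
  exact: measurable_sel (munif kn).
have hE w : hst k.+1 w = rcons (hst k w)
    (dst G (loc G (hst k w)) (sel G sig pi (hst k w) (unif k w)),
     upd G (loc G (hst k w)) (sel G sig pi (hst k w) (unif k w))
       (val G (hst k w)) (samp k w)).
  by rewrite /hst /= stepE.
have nthE w i : nth (l_init G, (0 : 'rV[R]_nX)) (hst k.+1 w) i =
   if (i < k.+1)%N then nth (l_init G, (0 : 'rV[R]_nX)) (hst k w) i
   else if i == k.+1 then
     (dst G (loc G (hst k w)) (sel G sig pi (hst k w) (unif k w)),
     upd G (loc G (hst k w)) (sel G sig pi (hst k w) (unif k w))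
       (val G (hst k w)) (samp k w))
   else (l_init G, (0 : 'rV[R]_nX)).
  by rewrite hE nth_rcons size_hist.
apply: (@measurability _ _ T H setT (hst k.+1) (hist_gens G) erefl) => _ [_ [[k' ->]|[[i [l ->]]|[i [j [B [mB ->]]]]]] <-];
  rewrite setTI.
- rewrite [X in measurable X](_ : _ = [set _ | k.+2 = k'])//.
  by apply/seteqP; split => w /=; rewrite size_rcons size_hist.
- have -> : hst k.+1 @^-1` [set h | (nth (l_init G, (0 : 'rV[R]_nX)) h i).1 = l] =
    [set w | (nth (l_init G, (0 : 'rV[R]_nX)) (hst k.+1 w) i).1 = l] by [].
  under eq_set do rewrite nthE.
  case: ltnP => ik.
    have := mh measurableT [set h | (nth (l_init G, (0 : 'rV[R]_nX)) h i).1 = l].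
    rewrite setTI; apply; apply: sub_sigma_algebra.
    by right; left; exists i, l.
  case: eqP => _ /=; last exact: mcst.
  rewrite [X in measurable X](_ : _ = [set w |
    dst G (loc G (hst k w)) (sel G sig pi (hst k w) (unif k w)) == l]); last first.
    by apply/seteqP; split => w /= /eqP.
  apply/measurable_bool_set.
  apply: (@measurable_by_loc L _ _ _ _ (fun w => loc G (hst k w))
    (fun l0 w => dst G l0 (sel G sig pi (hst k w) (unif k w)) == l)) => l0.
    by apply: (measurableT_comp (measurable_loc l0)).
  rewrite (_ : (fun w => _) = (fun w => if sel G sig pi (hst k w) (unif k w)
    then dst G l0 true == l else dst G l0 false == l)); last first.
    by apply/funext => w; case: sel.
  exact: measurable_fun_ifT.
- have -> : hst k.+1 @^-1` [set h | B ((nth (l_init G, (0 : 'rV[R]_nX)) h i).2 0 j)] =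
    [set w | B ((nth (l_init G, (0 : 'rV[R]_nX)) (hst k.+1 w) i).2 0 j)] by [].
  under eq_set do rewrite nthE.
  case: ltnP => ik.
    have := mh measurableT [set h | B ((nth (l_init G, (0 : 'rV[R]_nX)) h i).2 0 j)].
    rewrite setTI; apply; apply: sub_sigma_algebra.
    by right; right; exists i, j, B.
  case: eqP => _ /=; last exact: mcst.
  suff mu : measurable_fun setT (fun w => upd G (loc G (hst k w))
      (sel G sig pi (hst k w) (unif k w)) (val G (hst k w)) (samp k w) 0 j).
    by have := mu measurableT B mB; rewrite setTI.
  apply: (@measurable_by_loc L _ _ _ _ (fun w => loc G (hst k w))
    (fun l0 w => upd G l0 (sel G sig pi (hst k w) (unif k w))
       (val G (hst k w)) (samp k w) 0 j)) => l0.
    by apply: (measurableT_comp (measurable_loc l0)).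
  rewrite (_ : (fun w => _) = (fun w => if sel G sig pi (hst k w) (unif k w)
    then upd G l0 true (val G (hst k w)) (samp k w) 0 j
    else upd G l0 false (val G (hst k w)) (samp k w) 0 j)); last first.
    by apply/funext => w; case: sel.
  apply: measurable_fun_ifT => //; apply: measurable_affine_upd;
    do ?[exact: affine_upd_edge|move=> i'; exact: msamp
        |move=> i'; exact: (measurableT_comp (measurable_val i'))].
Qed.

End hist_measurable.

(** * Independence of the past *)

Section eq_distribution.
Context d (T : measurableType d) (R : realType) (P : probability T R) (f g : T -> R).
Context (mf : measurable_fun setT f) (mg : measurable_fun setT g).
Context (fg : forall B, measurable B -> P (f @^-1` B) = P (g @^-1` B)).

Lemma ge0_eq_distribution (X : R -> \bar R) :
  measurable_fun setT X -> (forall x, 0 <= X x)%E ->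
  (\int[P]_w X (f w) = \int[P]_w X (g w))%E.
Proof.
move=> mX X0.
transitivity (\int[pushforward P f]_y X y)%E.
  by rewrite ge0_integral_pushforward.
transitivity (\int[pushforward P g]_y X y)%E.
  apply: eq_measure_integral => A mA _; exact: fg.
by rewrite ge0_integral_pushforward.
Qed.

Lemma eq_distribution_integrable :
  P.-integrable setT (EFin \o f) -> P.-integrable setT (EFin \o g).
Proof.
move=> /integrableP[_ fi]; apply/integrableP; split; first exact/measurable_EFinP.
rewrite -(@ge0_eq_distribution (fun x => `|x%:E|%E))//.
by apply: measurableT_comp => //; exact/measurable_EFinP.
Qed.

Lemma eq_distribution_integral : (\int[P]_w f w = \int[P]_w g w)%R.
Proof.
have mE : measurable_fun setT (@EFin R) by exact/measurable_EFinP.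
have RE (h : T -> R) : (\int[P]_w h w)%R =
    fine (\int[P]_w (@EFin R)^\+ (h w) - \int[P]_w (@EFin R)^\- (h w))%E.
  by rewrite /Rintegral -[fun x => _]/(EFin \o h) integralE funepos_comp funeneg_comp.
have mEp : measurable_fun setT (@EFin R)^\+%E by exact: measurable_funepos.
have mEn : measurable_fun setT (@EFin R)^\-%E by exact: measurable_funeneg.
have Ep0 x : (0 <= (@EFin R)^\+ x)%E by exact: funepos_ge0.
have En0 x : (0 <= (@EFin R)^\- x)%E by exact: funeneg_ge0.
rewrite !RE; congr (fine (_ - _)%E).
  exact: ge0_eq_distribution mEp Ep0.
exact: ge0_eq_distribution mEn En0.
Qed.

End eq_distribution.

Section past.
Context (R : realType) (nR : nat) (d : measure_display) (Omega : measurableType d)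
  (P : probability Omega R)
  (samp : nat -> Omega -> 'rV[R]_nR) (unif : nat -> Omega -> R).
Context (ok : sampling_ok P samp unif).

Definition draw (i : nat) (B : 'I_nR -> set R) (C : set R) : set Omega :=
  [set w | forall j, B j (samp i w ord0 j)] `&` (unif i @^-1` C).

(** Only boxes are taken: they are closed under intersection and are the events to which the product
    formula in [sampling_ok] applies. The sigma-algebra they generate is the information in the
    first [n] draws. *)
Definition past (n : nat) : set (set Omega) :=
  [set A | exists (B : nat -> 'I_nR -> set R) (C : nat -> set R),
     [/\ (forall i j, measurable (B i j)), (forall i, measurable (C i)) &
         A = \bigcap_(i in `I_n) draw i (B i) (C i)]].

Lemma measurable_draw i B C : (forall j, measurable (B j)) -> measurable C ->
  measurable (draw i B C).
Proof.
move=> mB mC; have [ms mu _ _] := ok; apply: measurableI.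
  rewrite (_ : [set w | _] = \bigcap_(j in [set: 'I_nR]) [set w | B j (samp i w ord0 j)]).
    apply: fin_bigcap_measurable => [|j _]; first exact: finite_finset.
    by have := ms i j measurableT _ (mB j); rewrite setTI.
  by apply/seteqP; split => w /= h j; [move=> _|]; exact: h.
by have := mu i measurableT _ mC; rewrite setTI.
Qed.

Lemma past_measurable n : past n `<=` measurable.
Proof.
move=> _ [B [C [mB mC ->]]]; apply: bigcap_measurableType => i _.
exact: measurable_draw.
Qed.

Lemma past_setT n : past n setT.
Proof.
exists (fun _ _ => setT), (fun _ => setT); split => //.
by apply/seteqP; split => w // _ i _; split.
Qed.

Lemma past_setI n : setI_closed (past n).
Proof.
move=> _ _ [B [C [mB mC ->]]] [B' [C' [mB' mC' ->]]].
exists (fun i j => B i j `&` B' i j), (fun i => C i `&` C' i); split.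
- by move=> i j; exact: measurableI.
- by move=> i; exact: measurableI.
- apply/seteqP; split => w /=.
    move=> [h h'] i ni; have [hB hC] := h i ni; have [hB' hC'] := h' i ni.
    by split => //=.
  by move=> h; split=> i ni; have [hB hC] := h i ni;
    split; do ?[by case: hC|by move=> j; case: (hB j)].
Qed.

(** A box on the first [n] draws cut with an event on draw [n] is a box on the first [n.+1] draws,
    whose last factor splits off the product. *)
Lemma prob_past_draw n S B C : (forall j, measurable (B j)) -> measurable C ->
  past n S ->
  P (S `&` draw n B C) = (P S *
   (P [set w | forall j, B j (samp 0 w ord0 j)] *
    lebesgue_measure (C `&` `[0%R, 1%R])))%E.
Proof.
move=> mB mC [B0 [C0 [mB0 mC0 ->]]]; have [_ _ ind _] := ok.
pose B1 i := if i == n then B else B0 i.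
pose C1 i := if i == n then C else C0 i.
have := ind n.+1 B1 C1; rewrite big_ord_recr /= {3 4}/B1 eqxx.
have -> : \bigcap_(i in `I_n.+1) ([set w | forall j, B1 i j (samp i w ord0 j)] `&`
   (unif i @^-1` C1 i)) =
  \bigcap_(i in `I_n) draw i (B0 i) (C0 i) `&` draw n B C.
  apply/seteqP; split => w /=.
    move=> h; split=> [i /= ni|].
      have := h i (leqW ni); rewrite /B1 /C1; case: eqP => // ein.
      by move: ni; rewrite ein ltnn.
    by have := h n (ltnSn n); rewrite /B1 /C1 eqxx.
  move=> [h hn] i; rewrite /= ltnS leq_eqVlt /B1 /C1.
  by have [-> //|/= _ ni] := eqVneq i n; exact: h.
move=> ->; first last.
- by move=> i; rewrite /C1; case: ifP.
- by move=> i j; rewrite /B1; case: ifP.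
have -> : (\prod_(i < n) (P [set w | forall j, B1 i j (samp 0 w ord0 j)] *
    lebesgue_measure (C1 i `&` `[0%R, 1%R])) =
  \prod_(i < n) (P [set w | forall j, B0 i j (samp 0 w ord0 j)] *
    lebesgue_measure (C0 i `&` `[0%R, 1%R])))%E.
  by apply: eq_bigr => i _; rewrite /B1 /C1 (ltn_eqF (ltn_ord i)).
by rewrite -(ind n B0 C0 mB0 mC0) /C1 eqxx.
Qed.

Lemma prob_draw n B C : (forall j, measurable (B j)) -> measurable C ->
  P (draw n B C) = (P [set w | forall j, B j (samp 0 w ord0 j)] *
    lebesgue_measure (C `&` `[0%R, 1%R]))%E.
Proof.
move=> mB mC; have := prob_past_draw mB mC (past_setT n).
by rewrite setTI probability_setT mul1e.
Qed.

(** For a fixed draw event, both sides are finite measures in [S] that agree on the boxes. Only [S]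
    leaves the boxes; the draw event stays one, which suffices for tests on a single coordinate or
    on the uniform variable. *)
Lemma indep_past n S B C : (forall j, measurable (B j)) -> measurable C ->
  <<s past n >> S -> P (S `&` draw n B C) = (P S * P (draw n B C))%E.
Proof.
move=> mB mC; have mE := measurable_draw n mB mC.
have PE : P (draw n B C) = (fine (P (draw n B C)))%:E.
  by rewrite fineK// fin_num_measure.
have q0 : 0 <= fine (P (draw n B C)) by rewrite fine_ge0.
pose m1 : {measure set Omega -> \bar R} := mrestr P mE.
pose m2 : {measure set Omega -> \bar R} := mscale (NngNum q0) P.
move=> sS; suff : m1 S = m2 S.
  by rewrite /m1 /m2 /= /mrestr /mscale /= => ->; rewrite -PE muleC.
apply: (@g_sigma_algebra_measure_unique _ _ _ (past n) (@past_measurable n)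
  (fun _ => setT)) sS.
- by move=> _; exact: past_setT.
- by apply/seteqP; split => // w _; exists 0%N.
- exact: past_setI.
- move=> A pA; rewrite /m1 /m2 /= /mrestr /mscale /=.
  by rewrite (prob_past_draw mB mC pA) -(prob_draw n mB mC) -PE muleC.
- move=> _; rewrite /m1 /= /mrestr setTI.
  by rewrite ltey_eq fin_num_measure.
Qed.

Let pastT n := g_sigma_algebraType (past n).

Lemma measurable_samp_past n i j : (i < n)%N ->
  measurable_fun setT (fun w : pastT n => samp i w 0 j).
Proof.
move=> ni _ B mB; rewrite setTI; apply: sub_sigma_algebra.
exists (fun i' j' => if (i' == i) && (j' == j) then B else setT), (fun _ => setT).
split=> //; first by move=> ? ?; case: ifP.
apply/seteqP; split=> w /=.
  move=> Bw i' _; split => //= j'.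
  by case: ifPn => // /andP[/eqP -> /eqP ->].
by move=> /(_ i ni)[/= + _] => /(_ j); rewrite !eqxx.
Qed.

Lemma measurable_unif_past n i : (i < n)%N ->
  measurable_fun setT (unif i : pastT n -> R).
Proof.
move=> ni _ C mC; rewrite setTI; apply: sub_sigma_algebra.
exists (fun _ _ => setT), (fun i' => if i' == i then C else setT).
split=> //; first by move=> ?; case: ifP.
apply/seteqP; split=> w /=.
  move=> Cw i' _; split => //=.
  by case: ifPn => // /eqP ->.
by move=> /(_ i ni)[/= _ +]; rewrite /= eqxx.
Qed.

Lemma prob_samp_box n B : (forall j, measurable (B j)) ->
  P [set w | forall j, B j (samp n w ord0 j)] =
  P [set w | forall j, B j (samp 0 w ord0 j)].
Proof.
move=> mB; have := prob_draw n mB (@measurableT _ R).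
(* Leaving the uniform variable free contributes the factor 1, the length of the unit interval. *)
rewrite setTI lebesgue_measure_itv /= lte01 oppr0 adde0 mule1 => <-.
by congr (P _); apply/seteqP; split=> w //= -[].
Qed.

Lemma prob_unif n C : measurable C ->
  P (unif n @^-1` C) = lebesgue_measure (C `&` `[0%R, 1%R]).
Proof.
move=> mC; have := @prob_draw n (fun _ => setT) C (fun _ => measurableT) mC.
rewrite (_ : [set w | _] = setT)// ?probability_setT ?mul1e; last first.
  by apply/seteqP; split.
by move=> <-; congr (P _); apply/seteqP; split=> w //= -[].
Qed.

Lemma prob_samp n j B : measurable B ->
  P [set w | B (samp n w 0 j)] = P [set w | B (samp 0 w 0 j)].
Proof.
move=> mB; have := @prob_samp_box n (fun j' => if j' == j then B else setT).
rewrite (_ : [set w | _] = [set w | B (samp n w 0 j)]); last first.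
  apply/seteqP; split=> w /=; first by move=> /(_ j); rewrite eqxx.
  by move=> Bw j'; case: eqP => // ->.
rewrite (_ : [set w | forall j', _] = [set w | B (samp 0 w 0 j)]); last first.
  apply/seteqP; split=> w /=; first by move=> /(_ j); rewrite eqxx.
  by move=> Bw j'; case: eqP => // ->.
by apply=> j'; case: ifP.
Qed.

End past.

(** * Support of the sampling distribution *)

Section support.
Context (R : realType) (nR : nat) (d : measure_display) (Omega : measurableType d)
  (P : probability Omega R)
  (samp : nat -> Omega -> 'rV[R]_nR) (unif : nat -> Omega -> R).
Context (ok : sampling_ok P samp unif).

Let box (q : 'rV[R]_nR) (e : R) (i : nat) : set Omega :=
  [set w | forall j, `|samp i w ord0 j - q ord0 j| < e].

Let measurable_itv_ball (a e : R) : measurable [set x : R | `|x - a| < e].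
Proof.
apply/measurable_bool_set; apply: measurable_fun_ltr => //.
by apply: measurableT_comp => //; exact: measurable_funB.
Qed.

Let measurable_box q e i : measurable (box q e i).
Proof.
have := measurable_draw ok i
  (fun j => measurable_itv_ball (q ord0 j) e) (@measurableT _ R).
by congr measurable; apply/seteqP; split=> w //= -[].
Qed.

Let prob_box q e i : P (box q e i) = P (box q e 0).
Proof.
exact: (prob_samp_box ok i (fun j => measurable_itv_ball (q ord0 j) e)).
Qed.

(* The complement of the support is covered by the countably many null boxes
   with rational centres and radii. *)
Lemma negligible_out_of_range n :
  P.-negligible [set w | ~ in_range P samp (samp n w)].
Proof.
(* [unpickle] enumerates all pairs of a rational centre and a rational radius; numbers that code no
   pair get the empty set. *)
pose rbox (k : nat) i : set Omega :=
  if unpickle k is Some (q, e) then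
    box (map_mx ratr (q : 'rV[rat]_nR)) (ratr (e : rat)) i else set0.
(* Nullity is tested on sample 0, whose law defines [in_range], and is carried over to sample [n] by
   [prob_box]. *)
pose N k : set Omega := if P (rbox k 0) == 0%E then rbox k n else set0.
suff /negligibleS : [set w | ~ in_range P samp (samp n w)] `<=` \bigcup_k N k.
  apply; apply: negligible_bigcup => k; rewrite /N.
  case: ifPn => [/eqP|_]; last exact: negligible_set0.
  rewrite /rbox; case: (unpickle k) => [[q e]|] P0; last exact: negligible_set0.
  by apply/negligibleP; [exact: measurable_box|exact: etrans (prob_box _ _ _) P0].
move=> w /=; set r := samp n w => /existsNP[e] /not_implyP[e0 /negP].
rewrite -leNgt => Pe.
(* With radius below [e / 2] and centre closer to [r] than that radius, the rational box contains
   [r] and lies in the null box of radius [e] around [r]. *)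
have [e' /[!in_itv]/= /andP[e'0 e'e]] : exists e' : rat, ratr e' \in `]0, (e / 2)[.
  by have [|e' h] := @rat_in_itvoo R 0 (e / 2); [exact: divr_gt0|exists e'].
have /choice[q qr] (j : 'I_nR) : exists q : rat, `|r ord0 j - ratr q| < ratr e'.
  have [|q] := @rat_in_itvoo R (r ord0 j - ratr e') (r ord0 j + ratr e').
    by rewrite ltrD2l gtrN.
  rewrite in_itv /= => /andP[h1 h2]; exists q.
  by rewrite distrC ltr_distl h1 h2.
exists (pickle (\row_j q j : 'rV[rat]_nR, e')) => //=.
rewrite /N /rbox pickleK ifT.
  by move=> j; rewrite !mxE; exact: qr.
rewrite -measure_le0 (le_trans _ Pe)// le_measure ?inE//.
  exact: (measurable_box r e 0).
move=> w' h j; have := h j; rewrite !mxE => h1; have h2 := qr j.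
rewrite -(subrK (ratr (q j)) (samp 0 w' ord0 j)) -addrA.
rewrite (le_lt_trans (ler_normD _ _))// (splitr e).
rewrite ltrD ?(lt_trans h1)//.
by rewrite distrC (lt_trans h2).
Qed.

Lemma negligible_some_out_of_range :
  P.-negligible [set w | ~ forall n, in_range P samp (samp n w)].
Proof.
have /negligible_bigcup := negligible_out_of_range.
apply: negligibleS => w /= /existsNP[n nw].
by exists n.
Qed.

End support.

(** * Runs as finite paths of the game *)

Section path.
Context (R : realType) (nX nR : nat) (d : measure_display) (Omega : measurableType d)
  (P : probability Omega R)
  (samp : nat -> Omega -> 'rV[R]_nR) (unif : nat -> Omega -> R)
  (L : finType) (G : sgs R nX nR L) (x0 : 'rV[R]_nX) (wfG : wf_sgs G).

Lemma fin_path_rcons h c : fin_path P samp G x0 h ->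
  trans_rel P samp G (last (l_init G, x0) h) c -> fin_path P samp G x0 (rcons h c).
Proof.
move=> [h' [-> hP]] hc; exists (rcons h' c); split => // i.
rewrite size_rcons ltnS leq_eqVlt => /orP[/eqP ->|ih'].
  rewrite !nth_rcons /= ltnn eqxx ltnS leqnn.
  by rewrite (_ : nth _ _ _ = last (l_init G, x0) ((l_init G, x0) :: h'))// -nth_last.
by rewrite !nth_rcons /= !ltnS ih' ltnW//; exact: hP.
Qed.

Lemma fin_path_last h : fin_path P samp G x0 h ->
  last (l_init G, x0) h = (loc G h, val G h).
Proof. by move=> [h' [-> _]]; rewrite /loc /val /= -surjective_pairing. Qed.

Lemma fin_path_reachable h : fin_path P samp G x0 h ->
  reachable P samp G x0 (loc G h, val G h).
Proof. by move=> ph; exists h; split=> //; exact: fin_path_last. Qed.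

(** The condition on the samples mentions neither the schedulers nor [k], so one null set serves all
    times and all strategies. This makes the invariant available along a run. *)
Lemma fin_path_hist sig pi k w : (forall n, in_range P samp (samp n w)) ->
  fin_path P samp G x0 (hist samp unif G x0 sig pi k w).
Proof.
move=> inr; elim: k => [|k IH] /=; first by exists [::].
apply: fin_path_rcons => //; rewrite fin_path_last// stepE//.
set h := hist _ _ _ _ _ _ _ _; set b := sel _ _ _ _ _.
exists (edge_at G (loc G h) b), (samp k w); split; first exact: edge_at_in.
split => // kd; rewrite /= in kd *.
by rewrite /b /sel kd -det_edgeE//; exact: det_edge_sat.
Qed.

End path.

(** * Expectation after one step *)

Section real_integrals.
Context d (T : measurableType d) (R : realType) (P : probability T R).
Implicit Types f g : T -> R.

Lemma integrable_natr_bool (b : T -> bool) f : measurable_fun setT b ->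
  P.-integrable setT (EFin \o f) ->
  P.-integrable setT (EFin \o (fun w => (b w)%:R * f w)).
Proof.
move=> mb fi; apply: le_integrable (fi) => //.
  apply/measurable_EFinP; apply: measurable_funM; first exact: measurable_natr_bool.
  by apply/measurable_EFinP; exact: measurable_int fi.
by move=> w _ /=; rewrite lee_fin normrM; case: (b w); rewrite ?normr1 ?normr0 ?mul1r ?mul0r.
Qed.

Lemma integrable_sumR (I : Type) (s : seq I) (F : I -> T -> R) :
  (forall i, P.-integrable setT (EFin \o F i)) ->
  P.-integrable setT (EFin \o (fun w => \sum_(i <- s) F i w)).
Proof.
move=> Fi; rewrite (_ : EFin \o _ = fun w => (\sum_(i <- s) (F i w)%:E)%E).
  by apply: (@integrable_sum _ _ _ P) => // i _; exact: Fi.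
by apply/funext => w; rewrite /= sumEFin.
Qed.

Lemma Rintegral_sum (I : Type) (s : seq I) (F : I -> T -> R) :
  (forall i, P.-integrable setT (EFin \o F i)) ->
  \int[P]_w (\sum_(i <- s) F i w) = \sum_(i <- s) \int[P]_w F i w.
Proof.
move=> Fi; elim: s => [|i s IH].
  by rewrite big_nil; under eq_Rintegral do rewrite big_nil; rewrite Rintegral_cst// mul0r.
under eq_Rintegral do rewrite big_cons.
by rewrite RintegralD// ?IH ?big_cons//; exact: integrable_sumR.
Qed.

Lemma integrable_cstR (r : R) : P.-integrable setT (EFin \o (fun=> r)).
Proof. exact: finite_measure_integrable_cst. Qed.

Lemma Rintegral_constant (r : R) : \int[P]__ r = r.
Proof.
rewrite Rintegral_cst// -[RHS]mulr1; congr (_ * _).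
exact: (congr1 fine (probability_setT P)).
Qed.

Lemma integrable_addR f g : P.-integrable setT (EFin \o f) ->
  P.-integrable setT (EFin \o g) -> P.-integrable setT (EFin \o (fun w => f w + g w)).
Proof.
move=> fi gi; rewrite (_ : EFin \o _ = (EFin \o f) \+ (EFin \o g))%E//.
exact: integrableD.
Qed.

Lemma integrable_scaleR r f : P.-integrable setT (EFin \o f) ->
  P.-integrable setT (EFin \o (fun w => r * f w)).
Proof.
move=> fi; rewrite (_ : EFin \o _ = fun w => (r%:E * (f w)%:E)%E)//.
exact: (@integrableZl _ _ _ P setT measurableT r (EFin \o f)).
Qed.

Lemma integrable_subR f g : P.-integrable setT (EFin \o f) ->
  P.-integrable setT (EFin \o g) -> P.-integrable setT (EFin \o (fun w => f w - g w)).
Proof.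
move=> fi gi; apply: integrable_addR => //.
rewrite (_ : (fun w => - g w) = (fun w => -1 * g w)); first exact: integrable_scaleR.
by apply/funext => w; rewrite mulN1r.
Qed.

(** Off [N] the difference [g - f] equals its absolute value, whose integral is nonnegative. *)
Lemma le_ae_Rintegral (N : set T) f g : P.-negligible N ->
  P.-integrable setT (EFin \o f) -> P.-integrable setT (EFin \o g) ->
  (forall w, ~ N w -> f w <= g w) -> \int[P]_w f w <= \int[P]_w g w.
Proof.
move=> Nn fi gi fg; rewrite -subr_ge0 -RintegralB//.
have gfi : P.-integrable setT (EFin \o (fun w => g w - f w)).
  exact: integrable_subR.
have mgf : measurable_fun setT (fun w => g w - f w).
  by apply/measurable_EFinP; exact: measurable_int gfi.
rewrite /Rintegral (@ae_eq_integral _ _ _ P setT (fun w => `|g w - f w|%:E))//.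
- by rewrite fine_ge0// integral_ge0// => w _; rewrite lee_fin.
- exact/measurable_EFinP.
- by apply/measurable_EFinP; exact: measurableT_comp.
- apply: negligibleS Nn => w /= h.
  apply: contrapT => Nw; apply: h => _; congr EFin.
  by rewrite ger0_norm// subr_ge0 fg.
Qed.

Lemma Rintegral_natr_bool (b : T -> bool) : measurable_fun setT b ->
  \int[P]_w (b w)%:R = fine (P [set w | b w]).
Proof.
move=> mb; rewrite -[in RHS](setIT [set w | b w]) -integral_indic//.
  congr fine; apply: eq_integral => w _; congr EFin; rewrite indicE mem_setE.
  by rewrite -[w \in b]/(b w).
exact/measurable_bool_set.
Qed.

End real_integrals.

(** The absence of products of entries of [x] with entries of [r] is what later lets the mean be
    substituted for [r] under a history event. *)
Definition joint_affine (R : realType) (nX nR : nat)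
    (F : 'rV[R]_nX -> 'rV[R]_nR -> R) : Prop :=
  exists (a : 'rV[R]_nX) (c : 'rV[R]_nR) (b : R), forall x r,
    F x r = \sum_i a 0 i * x 0 i + \sum_j c 0 j * r 0 j + b.

Lemma joint_affine_upd (R : realType) (nX nR : nat)
    (f : 'rV[R]_nX -> 'rV[R]_nR -> 'rV[R]_nX) j :
  affine_upd f -> joint_affine (fun x r => f x r 0 j).
Proof.
move=> [A [B [c fE]]]; exists (\row_i A i j), (\row_i B i j), (c 0 j) => x r.
rewrite fE !mxE; congr (_ + _ + _); apply: eq_bigr => i _.
  by rewrite !mxE mulrC.
by rewrite !mxE mulrC.
Qed.

Lemma joint_affine_comp (R : realType) (nX nR : nat) (g : 'rV[R]_nX -> R)
    (f : 'rV[R]_nX -> 'rV[R]_nR -> 'rV[R]_nX) :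
  affine_fun g -> affine_upd f -> joint_affine (fun x r => g (f x r)).
Proof.
move=> [a [b gE]] [A [B [c fE]]].
(* The covector [a] is pulled back along the update; with dot products written as [y *m z^T] this is
   associativity. *)
exists (a *m A^T), (a *m B^T), (\sum_i a 0 i * c 0 i + b) => x r.
have scalE n (y : 'rV[R]_n) (z : 'rV[R]_n) : \sum_i y 0 i * z 0 i = (y *m z^T) 0 0.
  by rewrite mxE; apply: eq_bigr => i _; rewrite mxE.
rewrite gE fE !scalE !linearD /= !trmx_mul -!mulmxA.
have addE (y z : 'M[R]_1) : (y + z) 0 0 = y 0 0 + z 0 0 by rewrite mxE.
by rewrite !addE !addrA.
Qed.

Section expectation.
Context (R : realType) (nX nR : nat) (d : measure_display) (Omega : measurableType d)
  (P : probability Omega R)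
  (samp : nat -> Omega -> 'rV[R]_nR) (unif : nat -> Omega -> R)
  (L : finType) (G : sgs R nX nR L) (x0 : 'rV[R]_nX).
Context (ok : sampling_ok P samp unif) (wfG : wf_sgs G).
Context (sig pi : scheduler R nX L)
  (msig : sched_measurable G sig) (mpi : sched_measurable G pi).
Let H := g_sigma_algebraType (hist_gens G).
Let hst k : Omega -> H := hist samp unif G x0 sig pi k.

Definition mean_sample : 'rV[R]_nR := \row_j \int[P]_w samp 0 w 0 j.
Local Notation m := mean_sample.
Local Notation Pintegrable f := (P.-integrable setT (EFin \o f)).

Lemma measurable_samp k j : measurable_fun setT (fun w => samp k w 0 j).
Proof. by have [ms _ _ _] := ok. Qed.

Lemma measurable_unif k : measurable_fun setT (unif k).
Proof. by have [_ mu _ _] := ok. Qed.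

Lemma measurable_hst k : measurable_fun setT (hst k).
Proof.
apply: (@measurable_hist _ _ _ _ _ x0 wfG _ _ msig mpi _ _ _ _ k) => // i _.
  by move=> j; exact: measurable_samp.
exact: measurable_unif.
Qed.

Lemma indep_hist k S B C : measurable (S : set H) ->
  (forall j, measurable (B j)) -> measurable C ->
  P (hst k @^-1` S `&` draw samp unif k B C) =
    (P (hst k @^-1` S) * P (draw samp unif k B C))%E.
Proof.
move=> mS mB mC; apply: (indep_past ok) => //.
(* The history is measured over the sigma-algebra of the past, not that of [Omega], as [indep_past]
   asks. *)
have := @measurable_hist _ _ _ _ _ x0 wfG _ _ msig mpi _
  (g_sigma_algebraType (past samp unif k)) samp unif k
  (fun i ik j => @measurable_samp_past _ _ _ _ samp unif k i j ik)
  (fun i ik => @measurable_unif_past _ _ _ _ samp unif k i ik) k (leqnn k).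
by move=> /(_ measurableT _ mS); rewrite setTI.
Qed.

(** Here a function of the history is integrated and the event concerns the uniform variable; it
    will express the choice of a branch. *)
Lemma integral_indep_unif k (X : H -> R) C : measurable_fun setT X ->
  Pintegrable (fun w => X (hst k w)) -> measurable C ->
  \int[P]_w ((unif k w \in C)%:R * X (hst k w)) =
  fine (lebesgue_measure (C `&` `[0, 1])) * \int[P]_w X (hst k w).
Proof.
move=> mX iX mC; rewrite -(prob_unif ok k mC).
have uE : unif k @^-1` C = [set w | unif k w \in C].
  by apply/seteqP; split => w /=; rewrite inE.
have mU : measurable_fun setT (fun w => unif k w \in C).
  apply/measurable_bool_set; rewrite -uE -[X in measurable X]setTI.
  exact: measurable_unif.
rewrite uE; apply: (integral_indep (measurable_hst k)) => // S mS.
rewrite -uE (_ : unif k @^-1` C = draw samp unif k (fun _ => setT) C).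
  exact: indep_hist.
by apply/seteqP; split => w //= -[].
Qed.

(** Integrability is assumed for sample 0 only; equality of laws carries it to sample [k]. *)
Lemma integrable_samp k j : Pintegrable (fun w => samp k w 0 j).
Proof.
have [_ _ _ /(_ j) i0] := ok.
apply: (eq_distribution_integrable (measurable_samp 0 j) (measurable_samp k j)) => // B mB.
exact: esym (prob_samp ok k j mB).
Qed.

Lemma integral_samp k j : \int[P]_w samp k w 0 j = m 0 j.
Proof.
rewrite mxE; apply: (eq_distribution_integral (measurable_samp k j) (measurable_samp 0 j)) => B mB.
exact: (prob_samp ok k j mB).
Qed.

Lemma measurable_comp_hst d' (U : measurableType d') k (X : H -> U) :
  measurable_fun setT X -> measurable_fun setT (fun w => X (hst k w)).
Proof. by move=> mX; exact: measurableT_comp mX (measurable_hst k). Qed.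

(** The roles are opposite to those in [integral_indep_unif]: the event concerns the history and a
    coordinate of the sample is integrated. The mean stays under the integral so that the terms can
    be reassembled into an affine function. *)
Lemma integral_indep_samp k (b : H -> bool) j : measurable_fun setT b ->
  \int[P]_w ((b (hst k w))%:R * samp k w 0 j) = \int[P]_w ((b (hst k w))%:R * m 0 j).
Proof.
move=> mb; have mbh := measurable_comp_hst k mb.
rewrite RintegralZr//; last first.
  have := integrable_natr_bool mbh (integrable_cstR P 1).
  by under eq_fun do rewrite mulr1.
rewrite Rintegral_natr_bool// -(integral_samp k).
apply: (integral_indep (f := fun w => samp k w 0 j) (X := id)) => //.
- exact: measurable_samp.
- exact: integrable_samp.
move=> S mS; rewrite setIC muleC.
have mb' : measurable ([set h | b h] : set H) by exact/measurable_bool_set.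
(* A box that restricts coordinate [j] alone expresses an event on that coordinate. *)
have := @indep_hist k [set h | b h] (fun j' => if j' == j then S else setT) setT mb'.
have -> : draw samp unif k (fun j' => if j' == j then S else setT) setT
    = (fun w => samp k w 0 j) @^-1` S.
  apply/seteqP; split => w /=; first by move=> [/(_ j)]; rewrite eqxx.
  by move=> Sw; split => // j'; case: eqP => // ->.
by apply => // j'; case: ifP.
Qed.

Definition next_config k w : L * 'rV[R]_nX :=
  let s := sel G sig pi (hst k w) (unif k w) in
  (dst G (loc G (hst k w)) s, upd G (loc G (hst k w)) s (val G (hst k w)) (samp k w)).

Lemma hstS k w : hst k.+1 w = rcons (hst k w) (next_config k w).
Proof. by rewrite /hst /= stepE. Qed.

(** An indicator expansion over finitely many pairs; in each summand the location and the edge are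
    constants, so [eta] and the update become fixed affine maps. *)
Lemma split_choice (F : L * bool -> R) (q : L * bool) :
  F q = \sum_(p : L * bool) (q == p)%:R * F p.
Proof.
rewrite (bigD1 q) //= eqxx mul1r big1 ?addr0// => p.
by rewrite eq_sym => /negPf ->; rewrite mul0r.
Qed.

Let choice_at k w := (loc G (hst k w), sel G sig pi (hst k w) (unif k w)).

Lemma measurable_loc_sel d' (T : measurableType d') (f : T -> H) (v : T -> R) p :
  measurable_fun setT f -> measurable_fun setT v ->
  measurable_fun setT (fun w => (loc G (f w), sel G sig pi (f w) (v w)) == p).
Proof.
move=> mf mv; case: p => l b; under eq_fun do rewrite xpair_eqE.
apply: measurable_and; first exact: measurableT_comp (measurable_loc l) mf.
have ms := measurable_sel msig mpi mf mv.
case: b; first by under eq_fun do rewrite eqb_id.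
by under eq_fun do rewrite eqbF_neg; exact: measurable_neg.
Qed.

Lemma measurable_choice k p : measurable_fun setT (fun w => choice_at k w == p).
Proof. exact: measurable_loc_sel (measurable_hst k) (measurable_unif k). Qed.

Lemma measurable_choice0 p :
  measurable_fun setT (fun h : H => (loc G h, sel G sig pi h 0) == p).
Proof. exact: (@measurable_loc_sel _ H id (fun=> 0)). Qed.

Lemma integrable_joint_affine k F : joint_affine F ->
  (forall i, Pintegrable (fun w => val G (hst k w) 0 i)) ->
  Pintegrable (fun w => F (val G (hst k w)) (samp k w)).
Proof.
move=> [a [c [b FE]]] iv; under eq_fun do rewrite FE.
apply: integrable_addR; last exact: integrable_cstR.
apply: integrable_addR; apply: integrable_sumR => i; apply: integrable_scaleR => //.
exact: integrable_samp.
Qed.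

(** Induction along the run: the next valuation is a finite sum of indicators times affine functions
    of the current valuation and an integrable sample. *)
Lemma integrable_val k i : Pintegrable (fun w => val G (hst k w) 0 i).
Proof.
elim: k i => [|k IH] i; first exact: integrable_cstR.
under eq_fun do rewrite hstS val_rcons /=.
under eq_fun do rewrite (split_choice
  (fun p => upd G p.1 p.2 (val G (hst k _)) (samp k _) 0 i) (choice_at k _)).
apply: integrable_sumR => p; apply: integrable_natr_bool.
  exact: measurable_choice.
apply: (@integrable_joint_affine k (fun x r => upd G p.1 p.2 x r 0 i)) => //.
by apply: joint_affine_upd; exact: affine_upd_edge.
Qed.

Lemma integrable_joint_affine_mean k F : joint_affine F ->
  Pintegrable (fun w => F (val G (hst k w)) m).
Proof.
move=> [a [c [b FE]]]; under eq_fun do rewrite FE.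
apply: integrable_addR; last exact: integrable_cstR.
apply: integrable_addR; last exact: integrable_cstR.
by apply: integrable_sumR => i; apply: integrable_scaleR; exact: integrable_val.
Qed.

(** A substitute for conditioning on the history. The part depending on the valuation is the same on
    both sides, so only the terms linear in the sample need independence. *)
Lemma integral_joint_affine k F (b : H -> bool) : joint_affine F ->
  measurable_fun setT b ->
  \int[P]_w ((b (hst k w))%:R * F (val G (hst k w)) (samp k w)) =
  \int[P]_w ((b (hst k w))%:R * F (val G (hst k w)) m).
Proof.
move=> [a [c [e FE]]] mb; have mbh := measurable_comp_hst k mb.
have split r : (fun w => (b (hst k w))%:R * F (val G (hst k w)) (r w)) =
    (fun w => (b (hst k w))%:R * (\sum_i a 0 i * val G (hst k w) 0 i + e) +
      \sum_j c 0 j * ((b (hst k w))%:R * r w 0 j)).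
  apply/funext => w; rewrite FE addrAC mulrDr; congr (_ + _).
  by rewrite mulr_sumr; apply: eq_bigr => j _; rewrite mulrCA.
have i1 : Pintegrable (fun w => (b (hst k w))%:R * (\sum_i a 0 i * val G (hst k w) 0 i + e)).
  apply: integrable_natr_bool => //; apply: integrable_addR; last exact: integrable_cstR.
  by apply: integrable_sumR => i; apply: integrable_scaleR; exact: integrable_val.
have i2 j : Pintegrable (fun w => (b (hst k w))%:R * samp k w 0 j).
  by apply: integrable_natr_bool => //; exact: integrable_samp.
have i3 j : Pintegrable (fun w => (b (hst k w))%:R * m 0 j).
  by apply: integrable_natr_bool => //; exact: integrable_cstR.
have i2' j : Pintegrable (fun w => c 0 j * ((b (hst k w))%:R * samp k w 0 j)).
  exact: integrable_scaleR.
have i3' j : Pintegrable (fun w => c 0 j * ((b (hst k w))%:R * m 0 j)).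
  exact: integrable_scaleR.
rewrite (split (samp k)) (split (fun=> m)) !RintegralD//; try exact: integrable_sumR.
congr (_ + _); rewrite !Rintegral_sum//; apply: eq_bigr => j _.
by rewrite !RintegralZl// integral_indep_samp.
Qed.

Context (eta : L -> 'rV[R]_nX -> R) (aff : forall l, affine_fun (eta l)).

Let F (p : L * bool) (x : 'rV[R]_nX) (r : 'rV[R]_nR) : R :=
  eta (dst G p.1 p.2) (upd G p.1 p.2 x r).

Let jF p : joint_affine (F p).
Proof. by apply: joint_affine_comp => //; exact: affine_upd_edge. Qed.

(** [step] compares the uniform variable only with the probability of the first edge, so the second
    edge receives the rest; at a probabilistic location with a single edge, well-formedness makes
    that rest 0. *)
Definition branch_prob (l : L) (b : bool) : R :=
  if b then 1 - e_prob (edge_at G l 0) else e_prob (edge_at G l 0).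

Definition is_prob (l : L) : bool := if kind G l is KProb then true else false.

Lemma is_probP l : reflect (kind G l = KProb) (is_prob l).
Proof. by rewrite /is_prob; case: (kind G l); constructor. Qed.

(* The conditional expectation of eta at the next configuration given the
   history h.  Outside probabilistic locations sel ignores its last argument,
   so the value 0 is arbitrary. *)
Definition drift (h : H) : R :=
  if is_prob (loc G h) then
    \sum_(b : bool) branch_prob (loc G h) b * F (loc G h, b) (val G h) m
  else F (loc G h, sel G sig pi h 0) (val G h) m.

Lemma branch_prob_lebesgue l b : kind G l = KProb ->
  fine (lebesgue_measure ([set v | ~~ (v < e_prob (edge_at G l 0)) == b] `&` `[0, 1]))
  = branch_prob l b.
Proof.
move=> kl; set p := e_prob _.
have [p0 p1] : 0 <= p /\ p <= 1.
  have [_ [_ [_ [_ [_ [+ _]]]]]] := wfG.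
  move=> /(_ l kl)[]; rewrite /p /edge_at.
  have [[e ->]|[e1 [e2 ->]]] := out_cases wfG l => /= h.
    by rewrite big_seq1 => ->.
  rewrite big_cons big_seq1 => <-; split; first by apply: h; left.
  by rewrite lerDl h//; right; left.
rewrite /branch_prob -/p; case: b.
  rewrite (_ : _ `&` _ = `[p, 1]%classic); last first.
    apply/seteqP; split => v /=; rewrite !in_itv /= eqb_id -leNgt.
      by move=> [-> /andP[_ ->]].
    by move=> /andP[pv ->]; rewrite pv (le_trans p0).
  (* [lebesgue_measure_itv] tests whether the endpoints are strictly ordered, so [p = 1] is separate
     here, as [p = 0] is below. *)
  rewrite lebesgue_measure_itv /= lte_fin; move: p1; rewrite le_eqVlt => /orP[/eqP ->|->//].
  by rewrite ltxx subrr.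
rewrite (_ : _ `&` _ = `[0, p[%classic); last first.
  apply/seteqP; split => v /=; rewrite !in_itv /= eqbF_neg negbK.
    by move=> [-> /andP[->]].
  by move=> /andP[-> vp]; rewrite vp (ltW (lt_le_trans vp p1)).
rewrite lebesgue_measure_itv /= lte_fin; move: p0; rewrite le_eqVlt => /orP[/eqP <-|->//=].
  by rewrite ltxx.
by rewrite subr0.
Qed.

(** Puts [drift] in the shape that [split_choice] gives to the next value of [eta], so that the two
    can be compared pair by pair. At probabilistic locations the indicator of the chosen edge is
    already replaced by its probability. *)
Lemma driftE h : drift h =
  \sum_(p : L * bool)
    (if is_prob p.1 then branch_prob p.1 p.2 * ((loc G h == p.1)%:R * F p (val G h) m)
     else ((loc G h, sel G sig pi h 0) == p)%:R * F p (val G h) m).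
Proof.
rewrite -(pair_bigA _ (fun l b => if is_prob l
  then branch_prob l b * ((loc G h == l)%:R * F (l, b) (val G h) m)
  else ((loc G h, sel G sig pi h 0) == (l, b))%:R * F (l, b) (val G h) m)) /=.
rewrite (bigD1 (loc G h)) //= [X in _ + X]big1 ?addr0; last first.
  move=> l /negPf ll; rewrite big1// => b _.
  by rewrite xpair_eqE eq_sym ll /= !mul0r mulr0; case: ifP.
rewrite /drift; case: ifP => _.
  by apply: eq_bigr => b _; rewrite eqxx mul1r.
rewrite (bigD1 (sel G sig pi h 0)) //= eqxx mul1r big1 ?addr0// => b.
by rewrite xpair_eqE eqxx /= eq_sym => /negPf ->; rewrite mul0r.
Qed.

Lemma sel_prob l h v : loc G h = l -> kind G l = KProb ->
  sel G sig pi h v = ~~ (v < e_prob (edge_at G l 0)).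
Proof. by rewrite /sel => -> ->. Qed.

Lemma sel_nonprob h v : ~~ is_prob (loc G h) ->
  sel G sig pi h v = sel G sig pi h 0.
Proof. by rewrite /sel /is_prob; case: (kind G _). Qed.

Lemma measurable_affine_val (g : 'rV[R]_nX -> R) : affine_fun g ->
  measurable_fun setT (fun h : H => g (val G h)).
Proof. by move=> ag; apply: measurable_affine => // j; exact: measurable_val. Qed.

Lemma measurable_F p r : measurable_fun setT (fun h : H => F p (val G h) r).
Proof.
apply: (@measurable_affine_val (fun x => F p x r)).
have [a [c [b E]]] := jF p.
exists a, (\sum_j c 0 j * r 0 j + b) => x.
by rewrite E addrA.
Qed.

(** At a probabilistic location the update is the identity, so the mean may stand in for the sample,
    and the edge is chosen by the uniform variable, which is independent of the history. Elsewhere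
    the edge is a function of the history alone and [integral_joint_affine] applies. *)
Lemma integral_branch k p :
  \int[P]_w ((choice_at k w == p)%:R * F p (val G (hst k w)) (samp k w)) =
  \int[P]_w (if is_prob p.1
    then branch_prob p.1 p.2 * ((loc G (hst k w) == p.1)%:R * F p (val G (hst k w)) m)
    else ((loc G (hst k w), sel G sig pi (hst k w) 0) == p)%:R * F p (val G (hst k w)) m).
Proof.
have mloc : measurable_fun setT (fun h : H => loc G h == p.1) := measurable_loc p.1.
have ifm : Pintegrable (fun w => (loc G (hst k w) == p.1)%:R * F p (val G (hst k w)) m).
  apply: integrable_natr_bool; first exact: measurable_comp_hst mloc.
  exact: integrable_joint_affine_mean.
case: is_probP => [kp|kp]; last first.
  rewrite -(@integral_joint_affine k (F p)
     (fun h => (loc G h, sel G sig pi h 0) == p)) //.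
    apply: eq_Rintegral => w _; rewrite /choice_at.
    have [lp|/negPf lp] := eqVneq (loc G (hst k w)) p.1; last first.
      by case: p lp {mloc ifm kp} => l b lp; rewrite !xpair_eqE lp.
    have np : ~~ is_prob (loc G (hst k w)) by rewrite lp; exact/is_probP.
    by rewrite -(sel_nonprob (unif k w) np).
  exact: measurable_choice0.
rewrite RintegralZl// -branch_prob_lebesgue//.
set C := [set v | _]; have mC : measurable C.
  apply/measurable_bool_set.
  have mv : measurable_fun setT (fun v : R => v < e_prob (edge_at G p.1 0)) by exact: measurable_fun_ltr.
  case: (p.2); first by under eq_fun do rewrite eqb_id; exact: measurable_neg.
  by under eq_fun do rewrite eqbF_neg negbK.
rewrite -(@integral_indep_unif k (fun h => (loc G h == p.1)%:R * F p (val G h) m) C)//; last first.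
  apply: measurable_funM; first exact: measurable_natr_bool.
  exact: measurable_F.
apply: eq_Rintegral => w _; rewrite mulrA.
have -> : F p (val G (hst k w)) m = F p (val G (hst k w)) (samp k w).
  by rewrite /F !upd_id// kp.
congr (_ * _); rewrite mem_setE -[unif k w \in _]/(_ == p.2) -natrM mulnb; congr ((_ : bool)%:R).
have [lp|/negPf lp] := eqVneq (loc G (hst k w)) p.1.
  by case: p kp lp {mloc ifm C mC} => l b kp lp; rewrite /choice_at xpair_eqE lp eqxx (sel_prob _ lp)// andbT.
by case: p lp {mloc ifm kp C mC} => l b lp; rewrite /choice_at xpair_eqE lp andbF.
Qed.

Lemma integrable_eta k : Pintegrable (fun w => eta (loc G (hst k w)) (val G (hst k w))).
Proof.
under eq_fun do rewrite (split_choice (fun p => eta p.1 (val G (hst k _))) (choice_at k _)).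
apply: integrable_sumR => p; apply: integrable_natr_bool; first exact: measurable_choice.
have [a [b E]] := aff p.1; under eq_fun do rewrite E.
apply: integrable_addR; last exact: integrable_cstR.
by apply: integrable_sumR => i; apply: integrable_scaleR; exact: integrable_val.
Qed.

Lemma integrable_drift_term k p : Pintegrable (fun w => if is_prob p.1
    then branch_prob p.1 p.2 * ((loc G (hst k w) == p.1)%:R * F p (val G (hst k w)) m)
    else ((loc G (hst k w), sel G sig pi (hst k w) 0) == p)%:R * F p (val G (hst k w)) m).
Proof.
have iF := integrable_joint_affine_mean k (jF p).
case: (is_prob p.1).
  apply: integrable_scaleR; apply: integrable_natr_bool => //.
  exact: measurable_comp_hst (measurable_loc p.1).
apply: integrable_natr_bool => //.
exact: measurable_comp_hst (measurable_choice0 p).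
Qed.

Lemma integrable_drift k : Pintegrable (fun w => drift (hst k w)).
Proof.
under eq_fun do rewrite driftE; apply: integrable_sumR => p.
exact: integrable_drift_term.
Qed.

Lemma expected_eta_next k :
  \int[P]_w eta (loc G (hst k.+1 w)) (val G (hst k.+1 w)) = \int[P]_w drift (hst k w).
Proof.
transitivity (\int[P]_w \sum_(p : L * bool)
    (choice_at k w == p)%:R * F p (val G (hst k w)) (samp k w)).
  apply: eq_Rintegral => w _; rewrite hstS loc_rcons val_rcons.
  exact: (split_choice (fun p => F p (val G (hst k w)) (samp k w)) (choice_at k w)).
under [RHS]eq_Rintegral do rewrite driftE.
rewrite !Rintegral_sum.
- by apply: eq_bigr => p _; exact: integral_branch.
- by move=> p; exact: integrable_drift_term.
- move=> p; apply: integrable_natr_bool; first exact: measurable_choice.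
  by apply: integrable_joint_affine => // i; exact: integrable_val.
Qed.

End expectation.

(** * Termination time *)

(** Once false, [b] stays false, so its first false index counts the indices where it holds; if it
    is never false, both sides are infinite. This turns the termination time into a series of
    indicators. *)
Lemma ereal_inf_first_false (R : realType) (b : nat -> bool) :
  (forall k, ~~ b k -> ~~ b k.+1) ->
  (ereal_inf ((fun k : nat => (k%:R)%:E) @` [set k | ~~ b k]) =
   \sum_(0 <= k <oo) ((b k)%:R : R)%:E)%E.
Proof.
move=> bS; have b0 k : (0%N <= k)%N -> (0 <= ((b k)%:R : R)%:E)%E by rewrite lee_fin.
have [[N0 bN0]|bT] := pselect (exists k, ~~ b k); last first.
  have {}bT k : b k by apply: contrapT => /negP nb; apply: bT; exists k.
  rewrite (_ : [set k | _] = set0); last by apply/seteqP; split => k //=; rewrite bT.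
  rewrite image_set0 ereal_inf0; apply/esym/eq_infty => r.
  apply: le_trans (nneseries_lim_ge (Num.bound `|r|) (fun k k0 _ => b0 k k0)).
  rewrite (eq_bigr (fun=> 1%:E)) => [|k _]; last by rewrite bT.
  rewrite sumEFin big_const_nat subn0 iter_addr_0 lee_fin.
  by rewrite (le_trans (ler_norm r))// ltW// archi_boundP.
have exb : exists k, ~~ b k by exists N0.
have [N bN Nmin] := ex_minnP exb.
have bltN k : (k < N)%N -> b k.
  by rewrite ltnNge; apply: contraNT => /Nmin.
have bgeN k : (N <= k)%N -> ~~ b k.
  by elim: k => [|k IH]; [rewrite leqn0 => /eqP <-|rewrite leq_eqVlt => /orP[/eqP <-//|/IH/bS]].
rewrite (nneseries_split 0 N)// add0n eseries0; last first.
  by move=> i iN _; rewrite (negPf (bgeN i iN)).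
rewrite adde0 (eq_big_nat _ _ (F2 := fun=> 1%:E)) => [|k /andP[_ kN]]; last by rewrite bltN.
rewrite sumEFin big_const_nat subn0 iter_addr_0; apply/eqP; rewrite eq_le; apply/andP; split.
  by apply: ereal_inf_lbound; exists N.
by apply: le_ereal_inf_tmp => _ [k /= bk <-]; rewrite lee_fin ler_nat Nmin.
Qed.

(** * A measurable greedy scheduler *)

Section greedy.
Context (R : realType) (nX nR : nat) (L : finType) (G : sgs R nX nR L)
  (eta : L -> 'rV[R]_nX -> R).
Let H := g_sigma_algebraType (hist_gens G).

(** Reads only the last configuration, which makes it measurable when [eta] is affine. Ties go to
    the first edge; at a location with one edge both bits name that edge. *)
Definition greedy_sched : scheduler R nX L := fun h =>
  ~~ (eta (dst G (loc G h) false) (val G h) <= eta (dst G (loc G h) true) (val G h)).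

Lemma greedy_sched_measurable : (forall l, affine_fun (eta l)) ->
  sched_measurable G greedy_sched.
Proof.
move=> aff; apply/(@measurable_bool_set _ H); apply: measurable_neg.
apply: (@measurable_by_loc L _ H _ bool (fun h => loc G h) (fun l h =>
  eta (dst G l false) (val G h) <= eta (dst G l true) (val G h))) => l.
  exact: measurable_loc.
by apply: measurable_fun_ler; exact: measurable_affine_val.
Qed.

Lemma greedy_schedP d (Omega : measurableType d) (P : probability Omega R)
    (samp : nat -> Omega -> 'rV[R]_nR) (x0 : 'rV[R]_nX) : wf_sgs G ->
  greedy P samp G x0 eta greedy_sched.
Proof.
move=> wfG h /fin_path_last -> _ e /(edge_atP wfG)[b ->].
rewrite /greedy_sched -/(dst G _ _) -/(dst G _ b).
case: (leP (eta (dst G (loc G h) false) _)) => le; case: b => //=.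
exact: ltW.
Qed.

End greedy.

(** * The ranking inequality and its consequences for the termination time *)

Section ranking.
Context (R : realType) (nX nR : nat) (d : measure_display) (Omega : measurableType d)
  (P : probability Omega R)
  (samp : nat -> Omega -> 'rV[R]_nR) (unif : nat -> Omega -> R)
  (L : finType) (G : sgs R nX nR L) (x0 : 'rV[R]_nX).
Context (ok : sampling_ok P samp unif) (wfG : wf_sgs G).
Context (I : L -> lin_pred R nX) (eta : L -> 'rV[R]_nX -> R) (eps K K' : R).
Context (inv : lin_invariant P samp G x0 I) (lrsm : LRSM P samp G I eta eps K K').
Local Notation m := (mean_sample P samp).
Local Notation H := (g_sigma_algebraType (hist_gens G)).

Let eps_gt0 : 0 < eps.
Proof. by have [e1 _ _ _ _] := lrsm; exact: lt_le_trans e1. Qed.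

Let aff l : affine_fun (eta l).
Proof. by have [_ _ _ aff _] := lrsm. Qed.

(** An affine map commutes with expectation. This identifies the pre-expectation at deterministic
    locations with [drift], which uses the mean sample. *)
Lemma exp_updE (f : 'rV[R]_nX -> 'rV[R]_nR -> 'rV[R]_nX) x :
  affine_upd f -> exp_upd P samp f x = f x m.
Proof.
move=> af; apply/rowP => j; rewrite mxE.
have [a [c [b E]]] := joint_affine_upd j af.
rewrite -[LHS]/(\int[P]_w f x (samp 0 w) 0 j) E.
under eq_Rintegral do rewrite E.
have ic j' : P.-integrable setT (EFin \o (fun w => c 0 j' * samp 0 w 0 j')).
  by apply: integrable_scaleR; exact: (integrable_samp ok).
rewrite RintegralD//; last 2 first.
  by apply: integrable_addR; [exact: integrable_cstR|exact: integrable_sumR].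
  exact: integrable_cstR.
rewrite RintegralD//; last 2 first.
  exact: integrable_cstR.
  exact: integrable_sumR.
rewrite !Rintegral_constant Rintegral_sum//.
congr (_ + _ + _); apply: eq_bigr => j' _.
by rewrite RintegralZl ?(integral_samp ok)//; exact: (integrable_samp ok).
Qed.

Section schedulers.
Context (sig pi : scheduler R nX L) (msig : sched_measurable G sig)
  (mpi : sched_measurable G pi) (gsig : greedy P samp G x0 eta sig).
Let hst k : Omega -> H := hist samp unif G x0 sig pi k.
Local Notation Y k w := (eta (loc G (hst k w)) (val G (hst k w))).
Local Notation D := (drift (G := G) P samp sig pi eta).

(** Greediness matters only at angelic locations; a demonic choice is below the maximum, and at
    probabilistic and deterministic locations equality holds. *)
Lemma drift_le_pre_exp h : fin_path P samp G x0 h ->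
  D h <= pre_exp P samp G eta (loc G h) (val G h).
Proof.
move=> ph; have := gsig ph; rewrite (fin_path_last ph) /drift /pre_exp.
set l := loc G h; set x := val G h; set b := sel _ _ _ _ _.
rewrite /is_prob; case kl : (kind G l) => gr.
- rewrite upd_id ?kl//; have {}gr := gr erefl.
  rewrite (_ : b = sig h); last by rewrite /b /sel -/l kl.
  have le0 := gr _ (edge_at_in wfG l false).
  have le1 := gr _ (edge_at_in wfG l true).
  move: le0 le1; rewrite /dst /edge_at.
  have [[e ->]|[e1 [e2 ->]]] := out_cases wfG l; rewrite !big_cons big_nil /= => le0 le1.
    by rewrite !le_min le0.
  by rewrite !le_min le0 le1.
- rewrite upd_id ?kl// /dst /edge_at.
  have [[e ->]|[e1 [e2 ->]]] := out_cases wfG l; rewrite !big_cons big_nil /=.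
    by case: b; rewrite /= le_max lexx.
  by case: b; rewrite /= !le_max lexx ?orbT.
- have [_ [_ [_ [_ [_ [/(_ l kl)[_ +] _]]]]]] := wfG.
  rewrite big_bool /= !upd_id ?kl// /dst /branch_prob /edge_at.
  have [[e ->]|[e1 [e2 ->]]] := out_cases wfG l; rewrite !big_cons !big_nil /= !addr0.
    by move=> ->; rewrite subrr mul0r add0r.
  by move=> <-; rewrite [leRHS]addrC (addrC (e_prob e1)) addrK.
- rewrite det_edgeE// exp_updE; last exact: affine_upd_edge.
  by rewrite /b /sel -/l kl -/x.
Qed.

(** The indicator makes one inequality valid at all times: the decrease condition says nothing at
    [l_out], but the self-loop there leaves [eta] unchanged. *)
Lemma drift_le_eta h : fin_path P samp G x0 h ->
  D h <= eta (loc G h) (val G h) - eps * (loc G h != l_out G)%:R.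
Proof.
move=> ph; have hI := inv (fin_path_reachable ph).
have [_ _ _ _ /(_ _ _ hI)[_ _ pre]] := lrsm.
have [lo|/eqP lo] := eqVneq (loc G h) (l_out G); last first.
  by rewrite mulr1; apply: le_trans (drift_le_pre_exp ph) (pre lo).
rewrite mulr0 subr0 /drift /is_prob lo; have [-> _] := wfG.
by rewrite dst_out// upd_out.
Qed.

(** Away from [l_out] nonnegativity of [eta] is more than enough, because [K' <= -1]. *)
Lemma eta_ge h : fin_path P samp G x0 h -> K' <= eta (loc G h) (val G h).
Proof.
move=> ph; have hI := inv (fin_path_reachable ph).
have [_ _ K'1 _ /(_ _ _ hI)[e0 eK _]] := lrsm.
have [/eK/andP[]//|/eqP/e0] := eqVneq (loc G h) (l_out G).
by apply: le_trans; rewrite (le_trans K'1)// lerN10.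
Qed.

Lemma measurable_not_out k : measurable_fun setT (fun w => loc G (hst k w) != l_out G).
Proof.
apply: measurable_neg; apply: (measurableT_comp (measurable_loc (l_out G))).
exact: (measurable_hst x0 ok wfG msig mpi).
Qed.

Lemma sum_not_out n :
  eps * \sum_(0 <= k < n) fine (P [set w | loc G (hst k w) != l_out G])
    <= eta (l_init G) x0 - \int[P]_w Y n w.
Proof.
elim: n => [|n IH].
  by rewrite big_nil mulr0 /hst /= Rintegral_constant subrr.
rewrite big_nat_recr//= mulrDr.
have iY := integrable_eta x0 ok wfG msig mpi aff n.
have iD := integrable_drift x0 ok wfG msig mpi aff n.
have iB : P.-integrable setT (EFin \o (fun w => (loc G (hst n w) != l_out G)%:R)).
  have := integrable_natr_bool (measurable_not_out n) (integrable_cstR P 1).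
  by under eq_fun do rewrite mulr1.
have iO := integrable_scaleR eps iB.
suff : \int[P]_w Y n.+1 w <= \int[P]_w Y n w -
    eps * fine (P [set w | loc G (hst n w) != l_out G]).
  move: IH; lra.
rewrite (expected_eta_next x0 ok wfG msig mpi aff) -Rintegral_natr_bool; last first.
  exact: measurable_not_out.
rewrite -RintegralZl//.
rewrite -RintegralB//; apply: (le_ae_Rintegral (negligible_some_out_of_range ok)) => //.
  exact: integrable_subR.
move=> w /contrapT inr; apply: drift_le_eta; exact: fin_path_hist.
Qed.

Lemma sum_not_out_le n :
  \sum_(0 <= k < n) fine (P [set w | loc G (hst k w) != l_out G])
    <= (eta (l_init G) x0 - K') / eps.
Proof.
rewrite ler_pdivlMr// mulrC (le_trans (sum_not_out n))// lerD2l lerN2.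
have -> : K' = \int[P]_w K' by rewrite Rintegral_constant.
apply: (le_ae_Rintegral (negligible_some_out_of_range ok)).
- exact: integrable_cstR.
- exact: (integrable_eta x0 ok wfG msig mpi aff n).
- move=> w /contrapT inr; apply: eta_ge; exact: fin_path_hist.
Qed.

Lemma term_timeE w : term_time samp unif G x0 sig pi w =
  (\sum_(0 <= k <oo) ((loc G (hst k w) != l_out G)%:R)%:E)%E.
Proof.
rewrite -ereal_inf_first_false; last first.
  move=> k; rewrite !negbK => /eqP lk.
  by rewrite /hst /= stepE// loc_rcons lk /= dst_out.
(* [theta] and [loc] take the last entry with different defaults; histories are never empty, so a
   case analysis on [k] makes them agree. *)
rewrite /term_time; congr (ereal_inf (_ @` _)); apply/seteqP; split=> k /=;
  rewrite negbK => /eqP; rewrite /theta /loc /hst; case: k => //= k; rewrite !last_rcons => /eqP //.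
Qed.

Lemma measurable_term_time : measurable_fun setT (term_time samp unif G x0 sig pi).
Proof.
rewrite (funext term_timeE); apply: ge0_emeasurable_sum => // k _.
by apply/measurable_EFinP; apply: measurable_natr_bool; exact: measurable_not_out.
Qed.

(** Monotone convergence exchanges series and integral, and the partial sums are those bounded in
    [sum_not_out_le]. *)
Lemma exp_term_time_le :
  (exp_term_time P samp unif G x0 sig pi <= ((eta (l_init G) x0 - K') / eps)%:E)%E.
Proof.
rewrite /exp_term_time; under eq_integral do rewrite term_timeE.
rewrite integral_nneseries//; last first.
  move=> k; apply/measurable_EFinP; apply: measurable_natr_bool.
  exact: measurable_not_out.
apply: lime_le; first by apply: is_cvg_nneseries => k _ _; apply: integral_ge0.
apply: nearW => n; have := sum_not_out_le n; rewrite -lee_fin; apply: le_trans.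
rewrite -sumEFin lee_sum// => k _; rewrite -Rintegral_natr_bool; last exact: measurable_not_out.
have iB : P.-integrable setT (EFin \o (fun w => (loc G (hst k w) != l_out G)%:R)).
  have := integrable_natr_bool (measurable_not_out k) (integrable_cstR P 1).
  by under eq_fun do rewrite mulr1.
by rewrite fineK//; exact: integrable_fin_num iB.
Qed.

Lemma prob_term_time_lty :
  P [set w | (term_time samp unif G x0 sig pi w < +oo)%E] = 1%E.
Proof.
set T := term_time samp unif G x0 sig pi; set A := [set w | (T w < +oo)%E].
have T0 w : (0 <= T w)%E by apply: le_ereal_inf_tmp => _ [k _ <-]; rewrite lee_fin.
have iT : P.-integrable setT T.
  apply/integrableP; split; first exact: measurable_term_time.
  under eq_integral do rewrite gee0_abs//.
  by apply: le_lt_trans exp_term_time_le _; rewrite ltry.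
(* An exact probability is claimed, so the null complement must also be known to be measurable. *)
have mA : measurable A.
  rewrite -[A]setTI; apply: emeasurable_fun_infty_o => //; exact: measurable_term_time.
have nA : P.-negligible (~` A).
  have := integrable_ae measurableT iT; apply: negligibleS => w /= nTw h; apply: nTw.
  by rewrite /A /= -ge0_fin_numE//; exact: h.
rewrite -[A]setCK probability_setC; last exact: measurableC.
by have /negligibleP -> := nA; [rewrite sube0|exact: measurableC].
Qed.

End schedulers.
End ranking.

Unset Implicit Arguments.

Theorem theorem1
  (R : realType) (nX nR : nat) (d : measure_display) (Omega : measurableType d)
  (P : probability Omega R) (samp : nat -> Omega -> 'rV[R]_nR)
  (unif : nat -> Omega -> R)
  (L : finType) (G : sgs R nX nR L) (x0 : 'rV[R]_nX)
  (I : L -> lin_pred R nX) (eta : L -> 'rV[R]_nX -> R) (eps K K' : R) :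
  sampling_ok P samp unif ->
  wf_sgs G ->
  lin_invariant P samp G x0 I ->
  LRSM P samp G I eta eps K K' ->
  (* (1) almost-sure termination under some (indeed any) eta-greedy sigma *)
  (exists sig, sched_measurable G sig /\ greedy P samp G x0 eta sig /\
     forall pi, sched_measurable G pi ->
       P [set w | (term_time samp unif G x0 sig pi w < +oo)%E] = 1%E) /\
  (forall sig, sched_measurable G sig -> greedy P samp G x0 eta sig ->
     forall pi, sched_measurable G pi ->
       P [set w | (term_time samp unif G x0 sig pi w < +oo)%E] = 1%E) /\
  (* (2) bounds on the expected termination time *)
  (forall sig, sched_measurable G sig -> greedy P samp G x0 eta sig ->
     (ereal_sup [set exp_term_time P samp unif G x0 sig pi
                 | pi in sched_measurable G]
      <= ((eta (l_init G) x0 - K') / eps)%:E)%E) /\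
  (ET P samp unif G x0 <= ((eta (l_init G) x0 - K') / eps)%:E)%E /\
  (ET P samp unif G x0 < +oo)%E.
Proof.
move=> ok wfG inv lrsm.
have bound sig : sched_measurable G sig -> greedy P samp G x0 eta sig ->
    (ereal_sup [set exp_term_time P samp unif G x0 sig pi
                | pi in sched_measurable G]
     <= ((eta (l_init G) x0 - K') / eps)%:E)%E.
  move=> msig gsig; apply: ge_ereal_sup => _ [pi mpi <-].
  exact: (exp_term_time_le ok wfG inv lrsm).
have finite sig : sched_measurable G sig -> greedy P samp G x0 eta sig ->
    forall pi, sched_measurable G pi ->
    P [set w | (term_time samp unif G x0 sig pi w < +oo)%E] = 1%E.
  by move=> msig gsig pi mpi; exact: (prob_term_time_lty ok wfG inv lrsm).
(* One admissible greedy scheduler serves twice: as the witness in (1) and as the competitor that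
   bounds the infimum in [ET]. *)
have mg : sched_measurable G (greedy_sched G eta).
  by apply: greedy_sched_measurable; have [_ _ _ aff _] := lrsm.
have gg : greedy P samp G x0 eta (greedy_sched G eta) by exact: greedy_schedP.
have ETle : (ET P samp unif G x0 <= ((eta (l_init G) x0 - K') / eps)%:E)%E.
  apply: le_trans (bound _ mg gg).
  by apply: ereal_inf_lbound; exists (greedy_sched G eta).
split; first by exists (greedy_sched G eta); split=> //; split=> //; exact: finite.
do 3 split => //.
by apply: le_lt_trans ETle _; rewrite ltry.
Qed.
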